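(* Let $\mathcal R$ be a right bialgebroid over $A$ and $\Lambda\in\mathcal{YD}^{\mathcal R}_{\mathcal R}$ a right-right Yetter-Drinfeld module. If $\mathcal R$ and $\Lambda$ are both right finitely generated projective $A$-modules, then $\Lambda^\vee\in{}^{\mathcal R^\vee}\mathcal{YD}_{\mathcal R^\vee}$ (i.e. $\Lambda^\vee$ is a left-right Yetter-Drinfeld module of $\mathcal R^\vee$), and it is a left finitely generated projective $A$-module. Similarly, let $\Omega$ be a right bialgebroid over $A$ and $T\in{}^{\Omega}\mathcal{YD}_{\Omega}$ a left-right Yetter-Drinfeld module. If $\Omega$ and $T$ are left finitely generated projective $A$-modules, then ${}^\vee T\in\mathcal{YD}^{{}^\vee\Omega}_{{}^\vee\Omega}$, and it is a right finitely generated projective $A$-module. Moreover, $\Lambda\simeq{}^\vee(\Lambda^\vee)$ and $T\simeq({}^\vee T)^\vee$ as Yetter-Drinfeld modules.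
   Context: All algebras are unital and associative over a field $k$. Right bialgebroid over $A$: an algebra $\mathcal R$ with algebra maps $s_R:A\to\mathcal R$, $t_R:A^{op}\to\mathcal R$ with commuting images and a coalgebra structure $(\Delta_R,\varepsilon_R)$ in $A$-bimodules for $c\cdot X\cdot b=Xs_R(b)t_R(c)$ (so $Xs_R(a)\otimes_AY=X\otimes_AYt_R(a)$), such that $\Delta_R$ is an algebra map into $\{\sum X_i\otimes_AY_i:\sum s_R(a)X_i\otimes_AY_i=\sum X_i\otimes_At_R(a)Y_i\ \forall a\in A\}$ with factorwise product, $\varepsilon_R(1)=1$, $\varepsilon_R(s_R(\varepsilon_R(X))Y)=\varepsilon_R(XY)=\varepsilon_R(t_R(\varepsilon_R(X))Y)$. Write $\Delta_R(X)=X_{[1]}\otimes_AX_{[2]}$; the same letters $s_R,t_R,\varepsilon$ are used for every right bialgebroid. Right $\mathcal R$-comodule: $A$-bimodule $\Gamma$ ($a\cdot\rho\cdot a'$) with coassociative counital $\delta_R(\rho)=\rho_{[0]}\otimes_A\rho_{[1]}\in\Gamma\otimes_A\mathcal R$ ($\rho\cdot a\otimes_AX=\rho\otimes_AXt_R(a)$), $\delta_R(a\cdot\rho\cdot a')=\rho_{[0]}\otimes_As_R(a)\rho_{[1]}s_R(a')$, image in $\{\sum a\cdot\rho_i\otimes X_i=\sum\rho_i\otimes t_R(a)X_i\ \forall a\}$. Left $\mathcal R$-comodule: $A$-bimodule ($a\star\rho\star a'$) with coassociative counital ${}_R\delta(\rho)=\rho_{[-1]}\otimes_A\rho_{[0]}\in\mathcal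 R\otimes_A\Gamma$ ($Xs_R(a)\otimes_A\rho=X\otimes_Aa\star\rho$), ${}_R\delta(a\star\rho\star a')=t_R(a')\rho_{[-1]}t_R(a)\otimes_A\rho_{[0]}$, image in $\{\sum s_R(a)X_i\otimes\rho_i=\sum X_i\otimes\rho_i\star a\ \forall a\}$. Right-right Yetter-Drinfeld module of $\mathcal R$ (category $\mathcal{YD}^{\mathcal R}_{\mathcal R}$): right $\mathcal R$-comodule and right $\mathcal R$-module ($\blacktriangleleft$) with $\rho\blacktriangleleft s_R(a)=\rho\cdot a$, $\rho\blacktriangleleft t_R(a)=a\cdot\rho$, $(\rho\blacktriangleleft X_{[2]})_{[0]}\otimes_AX_{[1]}(\rho\blacktriangleleft X_{[2]})_{[1]}=\rho_{[0]}\blacktriangleleft X_{[1]}\otimes_A\rho_{[1]}X_{[2]}$. Left-right Yetter-Drinfeld module of $\mathcal R$ (category ${}^{\mathcal R}\mathcal{YD}_{\mathcal R}$): left $\mathcal R$-comodule and right $\mathcal R$-module with $\rho\blacktriangleleft s_R(a)=\rho\star a$, $\rho\blacktriangleleft t_R(a)=a\star\rho$, $X_{[2]}(\rho\blacktriangleleft X_{[1]})_{[-1]}\otimes_A(\rho\blacktriangleleft X_{[1]})_{[0]}=\rho_{[-1]}X_{[1]}\otimes_A\rho_{[0]}\blacktriangleleft X_{[2]}$. Duals. A right (left) finitely generated projective module is one with a finite dual basis. Bialgebroids are $A$-modules via $X\cdot a=Xs_R(a)$, $a\cdot X=Xt_R(a)$; Yetter-Drinfeld modules via their $A$-bimodule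 structures. For an $A$-bimodule $M$, $M^\vee$ is the set of right $A$-module maps $M\to A$, and ${}^\vee M$ the set of left $A$-module maps $M\to A$. If $\mathcal R$ is right finitely generated projective, $\mathcal R^\vee$ is a right bialgebroid over $A$: writing $(\alpha|X)=\alpha(X)$, its structure is determined by $(s_R(a)t_R(b)\alpha s_R(c)t_R(d)|X)=d(\alpha|s_R(c)t_R(a)Xt_R(b))$, $(\alpha\beta|X)=(\beta|X_{[2]}t_R(\alpha|X_{[1]}))$, $(\alpha|XY)=(\alpha_{[1]}|s_R(\alpha_{[2]}|X)Y)$, unit $\varepsilon_R$, counit $\varepsilon(\alpha)=(\alpha|1)$. If $\Omega$ is left finitely generated projective, ${}^\vee\Omega$ is a right bialgebroid over $A$: writing $(\alpha|X)=X(\alpha)$ for $X\in{}^\vee\Omega$, $\alpha\in\Omega$, its structure is determined by $(\alpha|s_R(c)t_R(a)Xs_R(f)t_R(b))=(s_R(a)t_R(b)\alpha s_R(c)|X)f$, $(\alpha|XY)=(\alpha_{[1]}s_R(\alpha_{[2]}|X)|Y)$, $(\alpha\beta|X)=(\beta|X_{[2]}t_R(\alpha|X_{[1]}))$, unit $\varepsilon_\Omega$, counit $\varepsilon(X)=(1|X)$. Structures on duals of Yetter-Drinfeld modules. With $(f,\eta)$ denoting evaluation, $\Lambda^\vee$ has $A$-bimodule structure $(a\star f\star a',\eta)=a(f,\eta\blacktriangleleft t_R(a'))$, right $\mathcal R^\vee$-action $(f\blacktriangleleft\alpha,\eta)=(\alpha|\eta_{[1]}t_R(f,\eta_{[0]}))$,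 and left $\mathcal R^\vee$-coaction determined by $(f_{[-1]}|s_R(f_{[0]},\eta)X)=(f,\eta\blacktriangleleft X)$. The same two formulas, with $f\in T$, $\eta\in{}^\vee T$, $\alpha\in\Omega$, $X\in{}^\vee\Omega$, determine the right ${}^\vee\Omega$-coaction and right ${}^\vee\Omega$-action on ${}^\vee T$. *)

(* Defs.v *)
From HB Require Import structures.
From mathcomp Require Import all_boot all_algebra.
From mathcomp Require Import boolp classical_sets functions.

Set Implicit Arguments.
Unset Strict Implicit.
Unset Printing Implicit Defensive.

Import GRing.Theory.

Local Open Scope ring_scope.
Local Open Scope quotient_scope.

(* The ground ring [A] is noncommutative and one and the same space carries
   several [A]-actions (a bialgebroid has four), so actions are explicit
   functions [V -> A -> V] and [A -> V -> V].                                 *)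

Section Tensor.
Variables (A : Type) (M N : zmodType) (r : M -> A -> M) (l : A -> N -> N).

(* A formal sum [:: (x1, y1); ...; (xn, yn)] stands for the sum of the
   [xi (x) yi].  Only the relation [(0, y) ~ [::]] is needed to make the
   quotient a group: the inverse of (x, y) is (- x, y).                       *)
Inductive tensor_rel : seq (M * N) -> seq (M * N) -> Prop :=
| TRrefl s : tensor_rel s s
| TRsym s t : tensor_rel s t -> tensor_rel t s
| TRtrans s t u : tensor_rel s t -> tensor_rel t u -> tensor_rel s u
| TRcat s s' t t' :
    tensor_rel s t -> tensor_rel s' t' -> tensor_rel (s ++ s') (t ++ t')
| TRcatC s t : tensor_rel (s ++ t) (t ++ s)
| TR0 y : tensor_rel [:: (0, y)] [::]
| TRaddl x x' y : tensor_rel [:: (x + x', y)] [:: (x, y); (x', y)]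
| TRaddr x y y' : tensor_rel [:: (x, y + y')] [:: (x, y); (x, y')]
| TRbal x a y : tensor_rel [:: (r x a, y)] [:: (x, l a y)].

Definition tensor_equiv_rel : rel (seq (M * N)) :=
  fun s t => `[< tensor_rel s t >].

Lemma tensor_equiv_refl : reflexive tensor_equiv_rel.
Proof. by move=> s; apply/asboolP; apply: TRrefl. Qed.

Lemma tensor_equiv_sym : symmetric tensor_equiv_rel.
Proof. by move=> s t; apply/asboolP/asboolP; apply: TRsym. Qed.

Lemma tensor_equiv_trans : transitive tensor_equiv_rel.
Proof.
by move=> t s u /asboolP st /asboolP tu; apply/asboolP; apply: TRtrans st tu.
Qed.

Canonical tensor_equiv := EquivRel tensor_equiv_rel
  tensor_equiv_refl tensor_equiv_sym tensor_equiv_trans.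

Definition tensor : Type := {eq_quot tensor_equiv_rel}.

HB.instance Definition _ := Quotient.on tensor.
HB.instance Definition _ := Choice.on tensor.
HB.instance Definition _ : EqQuotient _ tensor_equiv_rel tensor :=
  EqQuotient.on tensor.

Lemma tensor_piP (s t : seq (M * N)) :
  (\pi_tensor s = \pi_tensor t) <-> tensor_rel s t.
Proof.
split=> [/eqP|st]; first by rewrite eqmodE => /asboolP.
by apply/eqP; rewrite eqmodE; apply/asboolP.
Qed.

Lemma tensor_reprP (s : seq (M * N)) : tensor_rel (repr (\pi_tensor s)) s.
Proof. by apply/tensor_piP; rewrite reprK. Qed.

Definition tensor_add (u v : tensor) : tensor := \pi_tensor (repr u ++ repr v).
Definition tensor_opp (u : tensor) : tensor :=
  \pi_tensor [seq (- p.1, p.2) | p <- repr u].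

Lemma tensor_addE s t :
  tensor_add (\pi_tensor s) (\pi_tensor t) = \pi_tensor (s ++ t).
Proof. by apply/tensor_piP; apply: TRcat; apply: tensor_reprP. Qed.

Lemma tensor_addA : associative tensor_add.
Proof.
elim/quotW=> s; elim/quotW=> t; elim/quotW=> u.
by rewrite (tensor_addE t u) (tensor_addE s t) (tensor_addE s (t ++ u))
  (tensor_addE (s ++ t) u) catA.
Qed.

Lemma tensor_addC : commutative tensor_add.
Proof.
elim/quotW=> s; elim/quotW=> t; rewrite (tensor_addE s t) (tensor_addE t s).
by apply/tensor_piP; apply: TRcatC.
Qed.

Lemma tensor_add0 : left_id (\pi_tensor [::]) tensor_add.
Proof. by elim/quotW=> s; rewrite (tensor_addE [::] s). Qed.

Lemma tensor_addN : left_inverse (\pi_tensor [::]) tensor_opp tensor_add.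
Proof.
move=> u; rewrite -{2}[u]reprK (tensor_addE _ (repr u)).
elim: (repr u) => [//|[x y] s IHs] /=.
set s' := [seq _ | _ <- _] in IHs *.
suff -> : \pi_tensor ((- x, y) :: s' ++ (x, y) :: s) = \pi_tensor (s' ++ s) by [].
apply/tensor_piP.
apply: (@TRtrans _ ([:: (- x, y); (x, y)] ++ (s' ++ s))).
  rewrite -cat1s -(cat1s (x, y) s) [X in tensor_rel _ (X ++ _)]/=.
  rewrite -(cat1s _ [:: (x, y)]) -!catA; apply: TRcat; first exact: TRrefl.
  by rewrite !catA; apply: TRcat; [apply: TRcatC|apply: TRrefl].
rewrite -[X in tensor_rel _ X]cat0s; apply: TRcat; last exact: TRrefl.
apply: (@TRtrans _ [:: (- x + x, y)]); first by apply: TRsym; apply: TRaddl.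
by rewrite addNr; apply: TR0.
Qed.

HB.instance Definition _ := GRing.isZmodule.Build tensor
  tensor_addA tensor_addC tensor_add0 tensor_addN.

Definition tens (x : M) (y : N) : tensor := \pi_tensor [:: (x, y)].

(* Sweedler notation: the sum of the [F x y] over the terms [x (x) y] of a
   chosen representative of [u].  By [tsum_tens] and [tsumD] below the choice
   does not matter when [F] is balanced.                                      *)
Definition tsum (G : zmodType) (u : tensor) (F : M -> N -> G) : G :=
  \sum_(p <- repr u) F p.1 p.2.

Definition balanced (G : zmodType) (F : M -> N -> G) : Prop :=
  [/\ forall x x' y, F (x + x') y = F x y + F x' y,
      forall x y y', F x (y + y') = F x y + F x y' &
      forall x a y, F (r x a) y = F x (l a y)].

Lemma tens_balanced : balanced tens.
Proof.
by split=> *; rewrite ?[RHS]tensor_addE; apply/tensor_piP;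
  [apply: TRaddl|apply: TRaddr|apply: TRbal].
Qed.

Section Universal.
Variables (G : zmodType) (F : M -> N -> G) (bF : balanced F).

Lemma tensor_rel_sum s t : tensor_rel s t ->
  \sum_(p <- s) F p.1 p.2 = \sum_(p <- t) F p.1 p.2.
Proof.
case: bF => Fl Fr Fa.
elim=> {s t} [//|s t _ -> //|s t u _ -> _ -> //|s s' t t' _ e1 _ e2|s t|y|x x' y
  |x y y'|x a y]; rewrite ?big_cat /= ?big_cons ?big_nil /= ?addr0.
- by rewrite e1 e2.
- by rewrite addrC.
- by apply: (addrI (F 0 y)); rewrite -Fl !addr0.
- exact: Fl.
- exact: Fr.
- exact: Fa.
Qed.

Lemma tsum_pi s : tsum (\pi_tensor s) F = \sum_(p <- s) F p.1 p.2.
Proof. exact/tensor_rel_sum/tensor_reprP. Qed.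

Lemma tsum_tens x y : tsum (tens x y) F = F x y.
Proof. by rewrite tsum_pi big_seq1. Qed.

Lemma tsumD u v : tsum (u + v) F = tsum u F + tsum v F.
Proof. by rewrite tsum_pi big_cat. Qed.

Lemma tsum0 : tsum 0 F = 0.
Proof. by rewrite tsum_pi big_nil. Qed.

Lemma tsum_sum (I : Type) (s : seq I) (E : I -> tensor) :
  tsum (\sum_(i <- s) E i) F = \sum_(i <- s) tsum (E i) F.
Proof. by elim/big_rec2: _ => [|i y x _ <-]; rewrite ?tsum0 ?tsumD. Qed.

End Universal.

Lemma tensorE (u : tensor) : u = tsum u tens.
Proof.
rewrite /tsum -{1}[u]reprK; elim: (repr u) => [|[x y] s IHs].
  by rewrite big_nil.
by rewrite big_cons -IHs [RHS]tensor_addE.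
Qed.

Lemma raddf_tsum (G H : zmodType) (h : G -> H) (F : M -> N -> G) u :
    h 0 = 0 -> {morph h : x y / x + y} ->
  h (tsum u F) = tsum u (fun x y => h (F x y)).
Proof. by move=> h0 hD; apply: (big_morph h hD h0). Qed.

Lemma eq_tsum (G : zmodType) (F F' : M -> N -> G) u :
  (forall x y, F x y = F' x y) -> tsum u F = tsum u F'.
Proof. by move=> eF; apply: eq_bigr => p _; apply: eF. Qed.

(* The right action on the second factor; used to form [(M (x) N) (x) P].     *)
Definition tensor_ract (B : Type) (r2 : N -> B -> N) (u : tensor) (b : B) :
  tensor := tsum u (fun x y => tens x (r2 y b)).

End Tensor.

Arguments tens {A M N r l} x y.

Notation "\tsum_ ( x , y <- u ) F" := (tsum u (fun x y => F))
  (at level 41, F at level 41, x name, y name, u at level 50,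
   format "'[' \tsum_ ( x ,  y  <-  u ) '/  '  F ']'").

Definition bilinear_map (k : fieldType) (U V W : lmodType k)
    (f : U -> V -> W) : Prop :=
  (forall v, linear (fun u => f u v)) /\ (forall u, linear (f u)).

Section Modules.
Variables (k : fieldType) (A : algType k).

Section Actions.
Variables (V : lmodType k) (l : A -> V -> V) (r : V -> A -> V).

Definition is_bimodule : Prop :=
  [/\ bilinear_map l /\ bilinear_map r,
      forall v, l 1 v = v /\ r v 1 = v,
      forall a b v, l (a * b) v = l a (l b v),
      forall v a b, r v (a * b) = r (r v a) b &
      forall a v b, l a (r v b) = r (l a v) b].

(* Linearity over [k] follows from [A]-linearity when [V] is a bimodule.      *)
Definition right_linear (f : V -> A) : Prop :=
  {morph f : u v / u + v} /\ forall v a, f (r v a) = f v * a.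

Definition left_linear (f : V -> A) : Prop :=
  {morph f : u v / u + v} /\ forall a v, f (l a v) = a * f v.

Definition right_fgp : Prop :=
  exists (n : nat) (e : 'I_n -> V) (f : 'I_n -> V -> A),
    (forall i, right_linear (f i)) /\
    (forall v, v = \sum_(i < n) r (e i) (f i v)).

Definition left_fgp : Prop :=
  exists (n : nat) (e : 'I_n -> V) (f : 'I_n -> V -> A),
    (forall i, left_linear (f i)) /\
    (forall v, v = \sum_(i < n) l (f i v) (e i)).

End Actions.

Section RightDual.
Variables (V : lmodType k) (r : V -> A -> V).

Definition right_linear_pred : {pred V -> A} :=
  fun f => `[< right_linear r f >].

Record rdual := RDual
  { rdual_fun :> V -> A; _ : rdual_fun \in right_linear_pred }.

HB.instance Definition _ := [isSub for rdual_fun].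
HB.instance Definition _ := [Choice of rdual by <:].

Fact rdual_submod : submod_closed right_linear_pred.
Proof.
split=> [|c f g /asboolP[fD fr] /asboolP[gD gr]]; apply/asboolP.
  by split=> [u v|v a]; rewrite /= ?addr0 ?mul0r.
split=> [u v|v a]; rewrite !fctE.
  by rewrite fD gD scalerDr addrACA.
by rewrite fr gr mulrDl scalerAl.
Qed.

HB.instance Definition _ := GRing.isSubmodClosed.Build k (V -> A)
  right_linear_pred rdual_submod.
HB.instance Definition _ := [SubChoice_isSubLmodule of rdual by <:].

(* The element of the dual with underlying map [f]; 0 if [f] is not linear.   *)
Definition rdual_of (f : V -> A) : rdual := insubd (0 : rdual) f.

Lemma rdualP (f : rdual) : right_linear r f.
Proof. by case: f => f /= /asboolP. Qed.

Lemma rdual_ofE f : right_linear r f -> rdual_of f =1 f.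
Proof. by move=> fP v; rewrite /rdual_of -[LHS]/(val _ v) insubdK //; apply/asboolP. Qed.

Lemma rdual_eq (f g : rdual) : f =1 g -> f = g.
Proof. by move=> fg; apply: val_inj; apply/funext. Qed.

Lemma rdualDE (f g : rdual) v : (f + g) v = f v + g v. Proof. by []. Qed.
Lemma rdualZE c (f : rdual) v : (c *: f) v = c *: f v. Proof. by []. Qed.
Lemma rdual0E v : (0 : rdual) v = 0. Proof. by []. Qed.

End RightDual.

Section LeftDual.
Variables (V : lmodType k) (l : A -> V -> V).

Definition left_linear_pred : {pred V -> A} :=
  fun f => `[< left_linear l f >].

Record ldual := LDual
  { ldual_fun :> V -> A; _ : ldual_fun \in left_linear_pred }.

HB.instance Definition _ := [isSub for ldual_fun].
HB.instance Definition _ := [Choice of ldual by <:].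

Fact ldual_submod : submod_closed left_linear_pred.
Proof.
split=> [|c f g /asboolP[fD fl] /asboolP[gD gl]]; apply/asboolP.
  by split=> [u v|a v]; rewrite /= ?addr0 ?mulr0.
split=> [u v|a v]; rewrite !fctE.
  by rewrite fD gD scalerDr addrACA.
by rewrite fl gl mulrDr scalerAr.
Qed.

HB.instance Definition _ := GRing.isSubmodClosed.Build k (V -> A)
  left_linear_pred ldual_submod.
HB.instance Definition _ := [SubChoice_isSubLmodule of ldual by <:].

Definition ldual_of (f : V -> A) : ldual := insubd (0 : ldual) f.

Lemma ldualP (f : ldual) : left_linear l f.
Proof. by case: f => f /= /asboolP. Qed.

Lemma ldual_ofE f : left_linear l f -> ldual_of f =1 f.
Proof. by move=> fP v; rewrite /ldual_of -[LHS]/(val _ v) insubdK //; apply/asboolP. Qed.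

Lemma ldual_eq (f g : ldual) : f =1 g -> f = g.
Proof. by move=> fg; apply: val_inj; apply/funext. Qed.

Lemma ldualDE (f g : ldual) v : (f + g) v = f v + g v. Proof. by []. Qed.
Lemma ldualZE c (f : ldual) v : (c *: f) v = c *: f v. Proof. by []. Qed.
Lemma ldual0E v : (0 : ldual) v = 0. Proof. by []. Qed.

End LeftDual.

End Modules.

(* The data only; [right_bialgebroid] below collects the axioms.  Separating
   the two lets the duals be written down before their axioms are proved.  The
   tensor product is that of the [A]-bimodule [c . X . b = X s(b) t(c)].       *)
Record bialgebroid_data (k : fieldType) (A : algType k) := BialgebroidData {
  bcar :> lmodType k;
  bmul : bcar -> bcar -> bcar;
  bone : bcar;
  bsrc : A -> bcar;
  btgt : A -> bcar;
  bcomul : bcar -> tensor (fun X a => bmul X (bsrc a))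
                          (fun a Y => bmul Y (btgt a));
  bcounit : bcar -> A
}.

Arguments bone {k A b}.
Arguments bsrc {k A b} a.
Arguments btgt {k A b} a.

Notation "X ** Y" := (bmul X Y) (at level 40, left associativity).

Section Bialgebroid.
Variables (k : fieldType) (A : algType k).

Definition bract (R : bialgebroid_data A) (X : R) (a : A) : R := X ** bsrc a.
Definition blact (R : bialgebroid_data A) (a : A) (X : R) : R := X ** btgt a.

Record right_bialgebroid (R : bialgebroid_data A) : Prop := {
  rb_mul_bilinear : bilinear_map (@bmul _ _ R);
  rb_mulA : associative (@bmul _ _ R);
  rb_mul1 : left_id bone (@bmul _ _ R) /\ right_id bone (@bmul _ _ R);
  rb_src : [/\ linear (@bsrc _ _ R), bsrc 1 = bone :> R &
               forall a b, bsrc (a * b) = bsrc a ** bsrc b :> R];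
  rb_tgt : [/\ linear (@btgt _ _ R), btgt 1 = bone :> R &
               forall a b, btgt (a * b) = btgt b ** btgt a :> R];
  rb_src_tgt : forall a b, bsrc a ** btgt b = btgt b ** bsrc a :> R;
  rb_comul_bimod : {morph @bcomul _ _ R : X Y / X + Y} /\
    forall c b (X : R), bcomul (bract (blact c X) b) =
      \tsum_(X1, X2 <- bcomul X) tens (blact c X1) (bract X2 b);
  rb_counit_bimod : {morph @bcounit _ _ R : X Y / X + Y} /\
    forall c b (X : R), bcounit (bract (blact c X) b) = c * bcounit X * b;
  rb_coassoc : forall X : R,
    \tsum_(X1, X2 <- bcomul X) tens (bcomul X1) X2 =
    \tsum_(X1, X2 <- bcomul X) \tsum_(Y1, Y2 <- bcomul X2)
       tens (tens X1 Y1) Y2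
    :> tensor (tensor_ract (@bract R)) (@blact R);
  rb_counit : forall X : R,
    \tsum_(X1, X2 <- bcomul X) blact (bcounit X1) X2 = X /\
    \tsum_(X1, X2 <- bcomul X) bract X1 (bcounit X2) = X;
  rb_takeuchi : forall a (X : R),
    \tsum_(X1, X2 <- bcomul X) tens (bsrc a ** X1) X2 =
    \tsum_(X1, X2 <- bcomul X) tens X1 (btgt a ** X2)
    :> tensor (@bract R) (@blact R);
  rb_comul_mul : forall X Y : R, bcomul (X ** Y) =
    \tsum_(X1, X2 <- bcomul X) \tsum_(Y1, Y2 <- bcomul Y)
       tens (X1 ** Y1) (X2 ** Y2);
  rb_comul_one : bcomul (bone : R) = tens bone bone;
  rb_counit_one : bcounit (bone : R) = 1;
  rb_counit_mul : forall X Y : R,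
    bcounit (bsrc (bcounit X) ** Y) = bcounit (X ** Y) /\
    bcounit (btgt (bcounit X) ** Y) = bcounit (X ** Y)
}.

(* Both kinds are right modules; [rr] has a right, [lr] a left coaction.
   Coproducts and coactions are only required to be additive: linearity over
   [k] is part of their compatibility with the [A]-bimodule structures.        *)
Record rr_data (R : bialgebroid_data A) := RRData {
  rr_car :> lmodType k;
  rr_lact : A -> rr_car -> rr_car;
  rr_ract : rr_car -> A -> rr_car;
  rr_coact : rr_car -> tensor rr_ract (@blact R);
  rr_act : rr_car -> R -> rr_car
}.

Record lr_data (R : bialgebroid_data A) := LRData {
  lr_car :> lmodType k;
  lr_lact : A -> lr_car -> lr_car;
  lr_ract : lr_car -> A -> lr_car;
  lr_coact : lr_car -> tensor (@bract R) lr_lact;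
  lr_act : lr_car -> R -> lr_car
}.

Section Predicates.
Variable R : bialgebroid_data A.

Definition is_right_module (V : lmodType k) (act : V -> R -> V) : Prop :=
  [/\ bilinear_map act, forall v, act v bone = v &
      forall v X Y, act v (X ** Y) = act (act v X) Y].

Record is_right_comodule (G : rr_data R) : Prop := {
  rc_bimod : is_bimodule (@rr_lact R G) (@rr_ract R G);
  rc_additive : {morph @rr_coact R G : x y / x + y};
  rc_bilinear : forall a (x : G) b, rr_coact (rr_lact a (rr_ract x b)) =
    \tsum_(x0, x1 <- rr_coact x) tens x0 (bsrc a ** x1 ** bsrc b);
  rc_takeuchi : forall a (x : G),
    \tsum_(x0, x1 <- rr_coact x) tens (rr_lact a x0) x1 =
    \tsum_(x0, x1 <- rr_coact x) tens x0 (btgt a ** x1)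
    :> tensor (@rr_ract R G) (@blact R);
  rc_coassoc : forall x : G,
    \tsum_(x0, x1 <- rr_coact x) tens (rr_coact x0) x1 =
    \tsum_(x0, x1 <- rr_coact x) \tsum_(X1, X2 <- bcomul x1)
       tens (tens x0 X1) X2
    :> tensor (tensor_ract (@bract R)) (@blact R);
  rc_counit : forall x : G,
    \tsum_(x0, x1 <- rr_coact x) rr_ract x0 (bcounit x1) = x
}.

Record is_left_comodule (G : lr_data R) : Prop := {
  lc_bimod : is_bimodule (@lr_lact R G) (@lr_ract R G);
  lc_additive : {morph @lr_coact R G : x y / x + y};
  lc_bilinear : forall a (x : G) b, lr_coact (lr_lact a (lr_ract x b)) =
    \tsum_(x1, x0 <- lr_coact x) tens (btgt b ** x1 ** btgt a) x0;
  lc_takeuchi : forall a (x : G),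
    \tsum_(x1, x0 <- lr_coact x) tens (bsrc a ** x1) x0 =
    \tsum_(x1, x0 <- lr_coact x) tens x1 (lr_ract x0 a)
    :> tensor (@bract R) (@lr_lact R G);
  lc_coassoc : forall x : G,
    \tsum_(x1, x0 <- lr_coact x) tens (bcomul x1) x0 =
    \tsum_(x1, x0 <- lr_coact x) \tsum_(y1, y0 <- lr_coact x0)
       tens (tens x1 y1) y0
    :> tensor (tensor_ract (@bract R)) (@lr_lact R G);
  lc_counit : forall x : G,
    \tsum_(x1, x0 <- lr_coact x) lr_lact (bcounit x1) x0 = x
}.

Record yd_right_right (G : rr_data R) : Prop := {
  rr_comod : is_right_comodule G;
  rr_mod : is_right_module (@rr_act R G);
  rr_act_src : forall (x : G) a, rr_act x (bsrc a) = rr_ract x a;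
  rr_act_tgt : forall (x : G) a, rr_act x (btgt a) = rr_lact a x;
  rr_yd : forall (x : G) (X : R),
    \tsum_(X1, X2 <- bcomul X) \tsum_(y0, y1 <- rr_coact (rr_act x X2))
       tens y0 (X1 ** y1) =
    \tsum_(x0, x1 <- rr_coact x) \tsum_(X1, X2 <- bcomul X)
       tens (rr_act x0 X1) (x1 ** X2)
    :> tensor (@rr_ract R G) (@blact R)
}.

Record yd_left_right (G : lr_data R) : Prop := {
  lr_comod : is_left_comodule G;
  lr_mod : is_right_module (@lr_act R G);
  lr_act_src : forall (x : G) a, lr_act x (bsrc a) = lr_ract x a;
  lr_act_tgt : forall (x : G) a, lr_act x (btgt a) = lr_lact a x;
  lr_yd : forall (x : G) (X : R),
    \tsum_(X1, X2 <- bcomul X) \tsum_(y1, y0 <- lr_coact (lr_act x X1))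
       tens (X2 ** y1) y0 =
    \tsum_(x1, x0 <- lr_coact x) \tsum_(X1, X2 <- bcomul X)
       tens (x1 ** X1) (lr_act x0 X2)
    :> tensor (@bract R) (@lr_lact R G)
}.

End Predicates.

Record bialgebroid_iso (R R' : bialgebroid_data A) (h : R -> R') : Prop := {
  bi_bij : bijective h;
  bi_linear : linear h;
  bi_mul : {morph h : X Y / X ** Y};
  bi_one : h bone = bone;
  bi_src : forall a, h (bsrc a) = bsrc a;
  bi_tgt : forall a, h (btgt a) = btgt a;
  bi_comul : forall X,
    bcomul (h X) = \tsum_(X1, X2 <- bcomul X) tens (h X1) (h X2);
  bi_counit : forall X, bcounit (h X) = bcounit X
}.

(* Isomorphisms of Yetter-Drinfeld modules over bialgebroids identified by
   the isomorphism [h].                                                       *)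
Record rr_iso (R R' : bialgebroid_data A) (h : R -> R')
    (G : rr_data R) (G' : rr_data R') (g : G -> G') : Prop := {
  rri_bij : bijective g;
  rri_linear : linear g;
  rri_lact : forall a x, g (rr_lact a x) = rr_lact a (g x);
  rri_ract : forall x a, g (rr_ract x a) = rr_ract (g x) a;
  rri_act : forall x X, g (rr_act x X) = rr_act (g x) (h X);
  rri_coact : forall x,
    rr_coact (g x) = \tsum_(x0, x1 <- rr_coact x) tens (g x0) (h x1)
}.

Record lr_iso (R R' : bialgebroid_data A) (h : R -> R')
    (G : lr_data R) (G' : lr_data R') (g : G -> G') : Prop := {
  lri_bij : bijective g;
  lri_linear : linear g;
  lri_lact : forall a x, g (lr_lact a x) = lr_lact a (g x);
  lri_ract : forall x a, g (lr_ract x a) = lr_ract (g x) a;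
  lri_act : forall x X, g (lr_act x X) = lr_act (g x) (h X);
  lri_coact : forall x,
    lr_coact (g x) = \tsum_(x1, x0 <- lr_coact x) tens (h x1) (g x0)
}.

End Bialgebroid.

(* The element of [T] determined by [P]; an arbitrary one (0 if none exists)
   when [P] does not determine it.  That the uses below are proper is proved in
   [rdual_comulP], [ldual_comulP], [rdual_coactP] and [ldual_coactP].          *)
Definition the_elt (T : zmodType) (P : T -> Prop) : T :=
  xget 0 [set t : T | P t]%classic.

Section Duals.
Variables (k : fieldType) (A : algType k).

(* (al | X) is [al X] in the right dual and [X al] in the left dual; (f, x) is
   [f x] in the right dual of a module and [x f] in its left dual.  The source
   and target are the case al = unit (resp. X = unit) of the formulas
     (s(a) t(b) al s(c) t(d) | X) = d (al | s(c) t(a) X t(b)),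
     (al | s(c) t(a) X s(f) t(b)) = (s(a) t(b) al s(c) | X) f,
   recovered in full as [rdual_bialgebroid_actE], [ldual_bialgebroid_actE].    *)
Section RightDualBialgebroid.
Variable R : bialgebroid_data A.

Local Notation D := (rdual (@bract k A R)).

Definition rdual_mul (al be : D) : D :=
  rdual_of _ (fun X => \tsum_(X1, X2 <- bcomul X) be (X2 ** btgt (al X1))).
Definition rdual_one : D := rdual_of _ (@bcounit _ _ R).
Definition rdual_src (a : A) : D :=
  rdual_of _ (fun X => bcounit (btgt a ** X)).
Definition rdual_tgt (b : A) : D :=
  rdual_of _ (fun X => bcounit (X ** btgt b)).

Definition rdual_tensor :=
  tensor (fun (al : D) a => rdual_mul al (rdual_src a))
         (fun a (be : D) => rdual_mul be (rdual_tgt a)).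

Definition rdual_comul_spec (al : D) (u : rdual_tensor) : Prop :=
  forall X Y, al (X ** Y) = \tsum_(al1, al2 <- u) al1 (bsrc (al2 X) ** Y).

Definition rdual_bialgebroid : bialgebroid_data A :=
  @BialgebroidData k A D rdual_mul rdual_one rdual_src rdual_tgt
    (fun al => the_elt (rdual_comul_spec al)) (fun al => al bone).

End RightDualBialgebroid.

Section LeftDualBialgebroid.
Variable R : bialgebroid_data A.

Local Notation D := (ldual (@blact k A R)).

Definition ldual_mul (X Y : D) : D :=
  ldual_of _ (fun al => \tsum_(al1, al2 <- bcomul al) Y (al1 ** bsrc (X al2))).
Definition ldual_one : D := ldual_of _ (@bcounit _ _ R).
Definition ldual_src (c : A) : D :=
  ldual_of _ (fun al => bcounit (al ** bsrc c)).
Definition ldual_tgt (a : A) : D :=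
  ldual_of _ (fun al => bcounit (bsrc a ** al)).

Definition ldual_tensor :=
  tensor (fun (X : D) a => ldual_mul X (ldual_src a))
         (fun a (Y : D) => ldual_mul Y (ldual_tgt a)).

Definition ldual_comul_spec (X : D) (u : ldual_tensor) : Prop :=
  forall al be, X (al ** be) =
    \tsum_(X1, X2 <- u) (ldual_mul X2 (ldual_tgt (X1 al))) be.

Definition ldual_bialgebroid : bialgebroid_data A :=
  @BialgebroidData k A D ldual_mul ldual_one ldual_src ldual_tgt
    (fun X => the_elt (ldual_comul_spec X)) (fun X => X bone).

End LeftDualBialgebroid.

Section RightDualYD.
Variables (R : bialgebroid_data A) (G : rr_data R).

Local Notation D := (rdual (@rr_ract k A R G)).

Definition rdual_lact (a : A) (f : D) : D := rdual_of _ (fun x => a * f x).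
Definition rdual_ract (f : D) (a : A) : D :=
  rdual_of _ (fun x => f (rr_act x (btgt a))).
Definition rdual_act (f : D) (al : rdual_bialgebroid R) : D :=
  rdual_of _ (fun x =>
    \tsum_(x0, x1 <- rr_coact x) (al : rdual _) (x1 ** btgt (f x0))).

Definition rdual_coact_spec (f : D)
    (u : tensor (@bract k A (rdual_bialgebroid R)) rdual_lact) : Prop :=
  forall x X, f (rr_act x X) =
    \tsum_(f1, f0 <- u) (f1 : rdual _) (bsrc (f0 x) ** X).

Definition rdual_yd : lr_data (rdual_bialgebroid R) :=
  @LRData k A (rdual_bialgebroid R) D rdual_lact rdual_ract
    (fun f => the_elt (rdual_coact_spec f)) rdual_act.

End RightDualYD.

Section LeftDualYD.
Variables (R : bialgebroid_data A) (T : lr_data R).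

Local Notation D := (ldual (@lr_lact k A R T)).

(* Forced by [x <| s(a) = x . a], [x <| t(a) = a . x] and the formula for the
   action below: (f, a . x . b) = (f * a, x) b, [*] the bimodule structure of
   [T].                                                                        *)
Definition ldual_lact (a : A) (x : D) : D :=
  ldual_of _ (fun f => x (lr_ract f a)).
Definition ldual_ract (x : D) (b : A) : D := ldual_of _ (fun f => x f * b).
Definition ldual_act (x : D) (X : ldual_bialgebroid R) : D :=
  ldual_of _ (fun f =>
    \tsum_(f1, f0 <- lr_coact f) (bsrc (x f0) ** X : ldual _) f1).

Definition ldual_coact_spec (x : D)
    (u : tensor ldual_ract (@blact k A (ldual_bialgebroid R))) : Prop :=
  forall f al, x (lr_act f al) =
    \tsum_(x0, x1 <- u) (x1 ** btgt (x0 f) : ldual _) al.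

Definition ldual_yd : rr_data (ldual_bialgebroid R) :=
  @RRData k A (ldual_bialgebroid R) D ldual_lact ldual_ract
    (fun x => the_elt (ldual_coact_spec x)) ldual_act.

End LeftDualYD.

Definition bialgebroid_ev_rl (R : bialgebroid_data A) (X : R) :
    ldual_bialgebroid (rdual_bialgebroid R) :=
  ldual_of _ (fun al : rdual_bialgebroid R => (al : rdual _) X).

Definition bialgebroid_ev_lr (R : bialgebroid_data A) (al : R) :
    rdual_bialgebroid (ldual_bialgebroid R) :=
  rdual_of _ (fun X : ldual_bialgebroid R => (X : ldual _) al).

End Duals.

Section TensLemmas.
Variables (A : Type) (M N : zmodType) (r : M -> A -> M) (l : A -> N -> N).
Local Notation tens := (@tens A M N r l).

Lemma tensDl x x' y : tens (x + x') y = tens x y + tens x' y.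
Proof. by case: (tens_balanced r l) => H _ _; apply: H. Qed.

Lemma tensDr x y y' : tens x (y + y') = tens x y + tens x y'.
Proof. by case: (tens_balanced r l) => _ H _; apply: H. Qed.

Lemma tens_bal x a y : tens (r x a) y = tens x (l a y).
Proof. by case: (tens_balanced r l) => _ _ H; apply: H. Qed.

Lemma tens_suml (I : Type) (s : seq I) (F : I -> M) y :
  tens (\sum_(i <- s) F i) y = \sum_(i <- s) tens (F i) y.
Proof.
apply: (big_morph (fun x => tens x y) (fun x x' => tensDl x x' y)).
by apply: (addrI (tens 0 y)); rewrite -tensDl !addr0.
Qed.

Lemma tens_sumr (I : Type) (s : seq I) (F : I -> N) x :
  tens x (\sum_(i <- s) F i) = \sum_(i <- s) tens x (F i).
Proof.
apply: (big_morph (tens x) (tensDr x)).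
by apply: (addrI (tens x 0)); rewrite -tensDr !addr0.
Qed.

Lemma tsum_tsum (B : Type) (M' N' : zmodType) (r' : M' -> B -> M')
    (l' : B -> N' -> N') (u : tensor r' l') (f : M' -> N' -> M)
    (g : M' -> N' -> N) (G : zmodType) (F : M -> N -> G) :
  balanced r l F ->
  tsum (\tsum_(x, y <- u) tens (f x y) (g x y)) F =
  \tsum_(x, y <- u) F (f x y) (g x y).
Proof.
move=> bF; rewrite {1 3}/tsum -/(tsum _ _) (tsum_sum bF).
by apply: eq_bigr => p _; rewrite (tsum_tens bF).
Qed.

End TensLemmas.

Lemma morphD0 (U W : zmodType) (f : U -> W) :
  {morph f : x y / x + y} -> f 0 = 0.
Proof. by move=> fD; apply: (addrI (f 0)); rewrite -fD !addr0. Qed.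

Section BilinearLemmas.
Variables (k : fieldType) (U V W : lmodType k) (f : U -> V -> W).
Hypothesis fB : bilinear_map f.

Lemma bilDl x x' y : f (x + x') y = f x y + f x' y.
Proof. by case: fB => H _; have := H y 1 x x'; rewrite !scale1r. Qed.

Lemma bilDr x y y' : f x (y + y') = f x y + f x y'.
Proof. by case: fB => _ H; have := H x 1 y y'; rewrite !scale1r. Qed.

End BilinearLemmas.

Section BialgebroidLemmas.
Variables (k : fieldType) (A : algType k) (R : bialgebroid_data A).
Hypothesis hR : right_bialgebroid R.
Implicit Types (X Y : R) (a b c : A).

Let mulA := rb_mulA hR.
Let mulDl := bilDl (rb_mul_bilinear hR).
Let mulDr := bilDr (rb_mul_bilinear hR).

Lemma rb_srcD a b : bsrc (a + b) = bsrc a + bsrc b :> R.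
Proof. by case: (rb_src hR) => H _ _; have := H 1 a b; rewrite !scale1r. Qed.
Lemma rb_tgtD a b : btgt (a + b) = btgt a + btgt b :> R.
Proof. by case: (rb_tgt hR) => H _ _; have := H 1 a b; rewrite !scale1r. Qed.
Lemma rb_srcM a b : bsrc (a * b) = bsrc a ** bsrc b :> R.
Proof. by case: (rb_src hR). Qed.
Lemma rb_tgtM a b : btgt (a * b) = btgt b ** btgt a :> R.
Proof. by case: (rb_tgt hR). Qed.
Lemma rb_src1 : bsrc 1 = bone :> R. Proof. by case: (rb_src hR). Qed.
Lemma rb_tgt1 : btgt 1 = bone :> R. Proof. by case: (rb_tgt hR). Qed.
Lemma rb_mul1l X : bone ** X = X. Proof. by case: (rb_mul1 hR). Qed.
Lemma rb_mul1r X : X ** bone = X. Proof. by case: (rb_mul1 hR). Qed.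

Lemma rb_comul_srcr X b :
  bcomul (X ** bsrc b) = \tsum_(X1, X2 <- bcomul X) tens X1 (X2 ** bsrc b).
Proof.
have [_ /(_ 1 b X)] := rb_comul_bimod hR.
rewrite /bract /blact rb_tgt1 rb_mul1r => ->.
by apply: eq_tsum => X1 X2; rewrite rb_mul1r.
Qed.

Lemma rb_comul_tgtr X b :
  bcomul (X ** btgt b) = \tsum_(X1, X2 <- bcomul X) tens (X1 ** btgt b) X2.
Proof.
have [_ /(_ b 1 X)] := rb_comul_bimod hR.
rewrite /bract /blact rb_src1 rb_mul1r => ->.
by apply: eq_tsum => X1 X2; rewrite rb_mul1r.
Qed.

Lemma rb_tens_balanced (f g : R -> R) :
  {morph f : x y / x + y} -> {morph g : x y / x + y} ->
  (forall x a, f (x ** bsrc a) = f x ** bsrc a) ->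
  (forall x a, g (x ** btgt a) = g x ** btgt a) ->
  balanced (fun x a => x ** bsrc a) (fun a x => x ** btgt a)
    (fun x y => tens (f x) (g y)
      : tensor (fun x a => x ** bsrc a) (fun a x => x ** btgt a)).
Proof.
move=> fD gD fs gt; split=> [x x' y|x y y'|x a y].
- by rewrite fD tensDl.
- by rewrite gD tensDr.
by rewrite fs gt tens_bal.
Qed.

Lemma rb_comul_src c : bcomul (bsrc c : R) = tens bone (bsrc c).
Proof.
rewrite -[bsrc c]rb_mul1l rb_comul_srcr (rb_comul_one hR) tsum_tens //.
split=> [x x' y|x y y'|x a y]; first by rewrite tensDl.
  by rewrite mulDl tensDr.
by rewrite (tens_bal (fun x a => x ** bsrc a)) -!mulA (rb_src_tgt hR).
Qed.

Lemma rb_comul_tgt c : bcomul (btgt c : R) = tens (btgt c) bone.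
Proof.
rewrite -[btgt c]rb_mul1l rb_comul_tgtr (rb_comul_one hR) tsum_tens //.
split=> [x x' y|x y y'|x a y]; first by rewrite mulDl tensDl.
  by rewrite tensDr.
rewrite -mulA (rb_src_tgt hR) mulA.
by rewrite (tens_bal (fun x a => x ** bsrc a)).
Qed.

Lemma rb_mull_balanced X : balanced (@bract k A R) (@blact k A R)
  (fun Y1 Y2 => \tsum_(X1, X2 <- bcomul X) tens (Y1 ** X1) (Y2 ** X2)
     : tensor (fun x a => x ** bsrc a) (fun a x => x ** btgt a)).
Proof.
split=> [x x' y|x y y'|x a y].
- rewrite /tsum -big_split /=; apply: eq_bigr => p _.
  by rewrite mulDl tensDl.
- rewrite /tsum -big_split /=; apply: eq_bigr => p _.
  by rewrite mulDl tensDr.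
pose h (u : tensor (@bract k A R) (@blact k A R)) :
    tensor (fun x a => x ** bsrc a) (fun a x => x ** btgt a) :=
  \tsum_(X1, X2 <- u) tens (x ** X1) (y ** X2).
have bh : balanced (@bract k A R) (@blact k A R)
   (fun X1 X2 => tens (x ** X1) (y ** X2)
     : tensor (fun x a => x ** bsrc a) (fun a x => x ** btgt a)).
  by apply: rb_tens_balanced => [? ?|? ?|? ?|? ?]; rewrite ?mulDr ?mulA.
have := congr1 h (rb_takeuchi hR a X).
rewrite /h !tsum_tsum // => e; rewrite -[LHS]/(tsum _ _) -[RHS]/(tsum _ _).
rewrite -[RHS](eq_tsum (F := fun X1 X2 => tens (x ** X1) (y ** (btgt a ** X2)))).
  by rewrite -e; apply: eq_tsum => X1 X2; rewrite mulA.
by move=> X1 X2; rewrite mulA.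
Qed.

Lemma rb_comul_srcl X c :
  bcomul (bsrc c ** X) = \tsum_(X1, X2 <- bcomul X) tens X1 (bsrc c ** X2).
Proof.
rewrite (rb_comul_mul hR) rb_comul_src (tsum_tens (rb_mull_balanced X)).
by apply: eq_tsum => X1 X2; rewrite rb_mul1l.
Qed.

Lemma rb_comul_tgtl X c :
  bcomul (btgt c ** X) = \tsum_(X1, X2 <- bcomul X) tens (btgt c ** X1) X2.
Proof.
rewrite (rb_comul_mul hR) rb_comul_tgt (tsum_tens (rb_mull_balanced X)).
by apply: eq_tsum => X1 X2; rewrite rb_mul1l.
Qed.

Lemma rb_counitD X Y : bcounit (X + Y) = bcounit X + bcounit Y.
Proof. by case: (rb_counit_bimod hR) => ->. Qed.

Lemma rb_counit_srcr X b : bcounit (X ** bsrc b) = bcounit X * b.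
Proof.
have [_ /(_ 1 b X)] := rb_counit_bimod hR.
by rewrite /bract /blact rb_tgt1 rb_mul1r mul1r.
Qed.

Lemma rb_counit_tgtr X b : bcounit (X ** btgt b) = b * bcounit X.
Proof.
have [_ /(_ b 1 X)] := rb_counit_bimod hR.
by rewrite /bract /blact rb_src1 rb_mul1r mulr1.
Qed.

Lemma rb_counit_src c : bcounit (bsrc c : R) = c.
Proof. by rewrite -[bsrc c]rb_mul1l rb_counit_srcr (rb_counit_one hR) mul1r. Qed.

Lemma rb_counit_srcl_tgtl X c : bcounit (bsrc c ** X) = bcounit (btgt c ** X).
Proof.
have [e1 e2] := rb_counit_mul hR (bsrc c) X.
by move: e1 e2; rewrite rb_counit_src => _ ->.
Qed.

Lemma rb_counitl X : \tsum_(X1, X2 <- bcomul X) X2 ** btgt (bcounit X1) = X.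
Proof. by case: (rb_counit hR X). Qed.

Lemma rb_counitr X : \tsum_(X1, X2 <- bcomul X) X1 ** bsrc (bcounit X2) = X.
Proof. by case: (rb_counit hR X). Qed.

Lemma rb_comulD X Y : bcomul (X + Y) = bcomul X + bcomul Y.
Proof. by case: (rb_comul_bimod hR) => ->. Qed.

End BialgebroidLemmas.

Section RightDualBialgebroidFormulas.
Variables (k : fieldType) (A : algType k) (R : bialgebroid_data A).
Hypothesis hR : right_bialgebroid R.
Implicit Types (X Y : R) (a b c d : A).

Let mulA := rb_mulA hR.
Let mulDl := bilDl (rb_mul_bilinear hR).
Let mulDr := bilDr (rb_mul_bilinear hR).

Local Notation D := (rdual (@bract k A R)).

Lemma rdualD (al : D) X Y : al (X + Y) = al X + al Y.
Proof. by case: (rdualP al) => ->. Qed.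
Lemma rdual0 (al : D) : al 0 = 0.
Proof. exact: morphD0 (rdualD al). Qed.
Lemma rdual_srcr (al : D) X a : al (X ** bsrc a) = al X * a.
Proof. by case: (rdualP al) => _ ->. Qed.

Lemma rdual_tsum (al : D) (B : Type) (M N : zmodType) (r : M -> B -> M)
    (l : B -> N -> N) (u : tensor r l) (F : M -> N -> R) :
  al (tsum u F) = \tsum_(x, y <- u) al (F x y).
Proof. by apply: raddf_tsum; [apply: rdual0|apply: rdualD]. Qed.

Lemma rdual_mul_balanced (al be : D) :
  balanced (fun X a => X ** bsrc a) (fun a X => X ** btgt a)
    (fun X1 X2 => be (X2 ** btgt (al X1))).
Proof.
split=> [x x' y|x y y'|x a y].
- by rewrite rdualD (rb_tgtD hR) mulDr rdualD.
- by rewrite mulDl rdualD.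
by rewrite rdual_srcr (rb_tgtM hR) mulA.
Qed.

Lemma rdual_mulE (al be : D) X :
  rdual_mul al be X = \tsum_(X1, X2 <- bcomul X) be (X2 ** btgt (al X1)).
Proof.
have bF := rdual_mul_balanced al be; rewrite rdual_ofE //.
split=> [Y Z|Y a]; first by rewrite (rb_comulD hR) (tsumD bF).
rewrite /bract (rb_comul_srcr hR) (tsum_tsum _ _ _ bF) (raddf_tsum (h := *%R^~ a)).
- by apply: eq_tsum => X1 X2; rewrite -mulA (rb_src_tgt hR) mulA rdual_srcr.
- exact: mul0r.
- by move=> x y; rewrite mulrDl.
Qed.

Lemma rdual_oneE X : rdual_one R X = bcounit X.
Proof.
rewrite rdual_ofE //; split=> [Y Z|Y a]; first exact: rb_counitD.
exact: rb_counit_srcr.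
Qed.

Lemma rdual_srcE a X : rdual_src R a X = bcounit (btgt a ** X).
Proof.
rewrite rdual_ofE //; split=> [Y Z|Y c].
  by rewrite mulDr (rb_counitD hR).
by rewrite /bract mulA (rb_counit_srcr hR).
Qed.

Lemma rdual_tgtE a X : rdual_tgt R a X = bcounit (X ** btgt a).
Proof.
rewrite rdual_ofE //; split=> [Y Z|Y c].
  by rewrite mulDl (rb_counitD hR).
by rewrite /bract -mulA (rb_src_tgt hR) mulA (rb_counit_srcr hR).
Qed.

Lemma rdual_mul_srcl a (al : D) X :
  rdual_mul (rdual_src R a) al X = al (btgt a ** X).
Proof.
rewrite rdual_mulE -[in RHS](rb_counitl hR (btgt a ** X)).
rewrite (rb_comul_tgtl hR) tsum_tsum ?rdual_tsum.
  by apply: eq_tsum => X1 X2; rewrite rdual_srcE.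
split=> [x x' y|x y y'|x c y]; first by rewrite (rb_counitD hR) (rb_tgtD hR) mulDr.
  by rewrite mulDl.
by rewrite (rb_counit_srcr hR) (rb_tgtM hR) mulA.
Qed.

Lemma rdual_mul_tgtl b (al : D) X :
  rdual_mul (rdual_tgt R b) al X = al (X ** btgt b).
Proof.
rewrite rdual_mulE -[in RHS](rb_counitl hR (X ** btgt b)).
rewrite (rb_comul_tgtr hR) tsum_tsum ?rdual_tsum.
  by apply: eq_tsum => X1 X2; rewrite rdual_tgtE.
split=> [x x' y|x y y'|x c y]; first by rewrite (rb_counitD hR) (rb_tgtD hR) mulDr.
  by rewrite mulDl.
by rewrite (rb_counit_srcr hR) (rb_tgtM hR) mulA.
Qed.

Lemma rb_counitr_balanced : balanced (fun X a => X ** bsrc a)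
  (fun a X => X ** btgt a) (fun X1 X2 => X1 ** bsrc (bcounit X2)).
Proof.
split=> [x x' y|x y y'|x c y]; first by rewrite mulDl.
  by rewrite (rb_counitD hR) (rb_srcD hR) mulDr.
by rewrite (rb_counit_tgtr hR) (rb_srcM hR) mulA.
Qed.

Lemma rdual_mul_srcr c (al : D) X :
  rdual_mul al (rdual_src R c) X = al (bsrc c ** X).
Proof.
rewrite rdual_mulE -[in RHS](rb_counitr hR (bsrc c ** X)).
rewrite (rb_comul_srcl hR) (tsum_tsum _ _ _ rb_counitr_balanced) rdual_tsum.
apply: eq_tsum => X1 X2; rewrite rdual_srcE -(rb_counit_srcl_tgtl hR) mulA.
by rewrite (rb_counit_tgtr hR) rdual_srcr.
Qed.

Lemma rdual_mul_tgtr d (al : D) X :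
  rdual_mul al (rdual_tgt R d) X = d * al X.
Proof.
rewrite rdual_mulE -[in RHS](rb_counitr hR X) rdual_tsum.
rewrite (raddf_tsum (h := *%R d)) ?mulr0 //; last exact: mulrDr.
apply: eq_tsum => X1 X2; rewrite rdual_tgtE !(rb_counit_tgtr hR).
by rewrite rdual_srcr.
Qed.

Lemma rdual_bialgebroid_actE a b c d (al : rdual_bialgebroid R) X :
  (bsrc a ** (btgt b ** (al ** bsrc c ** btgt d)) : rdual_bialgebroid R) X
    = d * al (bsrc c ** (btgt a ** X ** btgt b)) :> A.
Proof.
rewrite [LHS]rdual_mul_srcl [LHS]rdual_mul_tgtl [LHS]rdual_mul_tgtr.
by congr (_ * _); apply: rdual_mul_srcr.
Qed.

Lemma rdual_comul_balanced X Y :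
  balanced (fun (al : D) a => rdual_mul al (rdual_src R a))
           (fun a (be : D) => rdual_mul be (rdual_tgt R a))
           (fun al1 al2 => al1 (bsrc (al2 X) ** Y)).
Proof.
split=> [x x' y|x y y'|x c y]; first by [].
  by rewrite rdualDE (rb_srcD hR) mulDl rdualD.
by rewrite rdual_mul_srcr rdual_mul_tgtr (rb_srcM hR) -mulA.
Qed.

Lemma rdual_comulP (al : rdual_bialgebroid R) :
  right_fgp (@bract k A R) -> unique (rdual_comul_spec al) (bcomul al).
Proof.
move=> [n [e [f [flin fE]]]].
pose F i : D := rdual_of _ (f i); have FE i X : F i X = f i X by rewrite rdual_ofE.
have cE i Y : rdual_of (@bract k A R) (fun Y => al (e i ** Y)) Y = al (e i ** Y).
  rewrite rdual_ofE //; split=> [Z Z'|Z a]; first by rewrite mulDr rdualD.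
  by rewrite /bract mulA rdual_srcr.
have contract w : rdual_comul_spec al w ->
    w = \sum_(i < n) tens (rdual_of _ (fun Y => al (e i ** Y))) (F i).
  move=> wP; rewrite [LHS]tensorE.
  have tE (m g : D) : tens m g = \sum_(i < n) tens (rdual_mul m (rdual_src R (g (e i)))) (F i)
      :> rdual_tensor R.
    under [RHS]eq_bigr => i _ do rewrite (tens_bal (fun al a => rdual_mul al (rdual_src R a))).
    rewrite -tens_sumr; congr tens; apply: rdual_eq => X.
    rewrite [in LHS](fE X) (big_morph g (rdualD g) (rdual0 g)).
    rewrite (big_morph (fun h : D => h X) (fun h h' => rdualDE h h' X) (rdual0E _ X)).
    by apply: eq_bigr => i _; rewrite rdual_mul_tgtr FE -rdual_srcr.
  rewrite (eq_tsum _ tE) /tsum exchange_big /=; apply: eq_bigr => i _.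
  rewrite -tens_suml; congr tens; apply: rdual_eq => Y.
  rewrite (big_morph (fun h : D => h Y) (fun h h' => rdualDE h h' Y) (rdual0E _ Y)).
  by rewrite cE wP; apply: eq_bigr => p _; rewrite rdual_mul_srcr.
have ex : exists u, rdual_comul_spec al u.
  exists (\sum_(i < n) tens (rdual_of _ (fun Y => al (e i ** Y))) (F i)) => X Y.
  rewrite (tsum_sum (rdual_comul_balanced X Y)) {1}(fE X).
  rewrite (big_morph (fun Z => al (Z ** Y)) (id1 := 0) (op1 := +%R)).
  - apply: eq_bigr => i _; rewrite (tsum_tens (rdual_comul_balanced X Y)).
    by rewrite cE FE mulA.
  - by move=> Z Z'; rewrite mulDl rdualD.
  - by apply: (morphD0 (f := fun Z => al (Z ** Y))) => Z Z'; rewrite mulDl rdualD.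
split; first exact: (xgetPex 0 ex).
by move=> u /contract ->; apply: contract; exact: (xgetPex 0 ex).
Qed.

End RightDualBialgebroidFormulas.

Section LeftDualBialgebroidFormulas.
Variables (k : fieldType) (A : algType k) (R : bialgebroid_data A).
Hypothesis hR : right_bialgebroid R.
Implicit Types (al be : R) (a b c d : A).

Let mulA := rb_mulA hR.
Let mulDl := bilDl (rb_mul_bilinear hR).
Let mulDr := bilDr (rb_mul_bilinear hR).

Local Notation D := (ldual (@blact k A R)).

Lemma ldualD (X : D) al be : X (al + be) = X al + X be.
Proof. by case: (ldualP X) => ->. Qed.
Lemma ldual0 (X : D) : X 0 = 0.
Proof. exact: morphD0 (ldualD X). Qed.
Lemma ldual_tgtr (X : D) al a : X (al ** btgt a) = a * X al.
Proof. by case: (ldualP X) => _ ->. Qed.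

Lemma ldual_tsum (X : D) (B : Type) (M N : zmodType) (r : M -> B -> M)
    (l : B -> N -> N) (u : tensor r l) (F : M -> N -> R) :
  X (tsum u F) = \tsum_(x, y <- u) X (F x y).
Proof. by apply: raddf_tsum; [apply: ldual0|apply: ldualD]. Qed.

Lemma ldual_mul_balanced (X Y : D) :
  balanced (fun al a => al ** bsrc a) (fun a al => al ** btgt a)
    (fun al1 al2 => Y (al1 ** bsrc (X al2))).
Proof.
split=> [x x' y|x y y'|x a y].
- by rewrite mulDl ldualD.
- by rewrite ldualD (rb_srcD hR) mulDr ldualD.
by rewrite ldual_tgtr (rb_srcM hR) mulA.
Qed.

Lemma ldual_mulE (X Y : D) al :
  ldual_mul X Y al = \tsum_(al1, al2 <- bcomul al) Y (al1 ** bsrc (X al2)).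
Proof.
have bF := ldual_mul_balanced X Y; rewrite ldual_ofE //.
split=> [x y|a x]; first by rewrite (rb_comulD hR) (tsumD bF).
rewrite /blact (rb_comul_tgtr hR) (tsum_tsum _ _ _ bF) (raddf_tsum (h := *%R a)).
- by apply: eq_tsum => x1 x2; rewrite -mulA -(rb_src_tgt hR) mulA ldual_tgtr.
- exact: mulr0.
- by move=> x' y; rewrite mulrDr.
Qed.

Lemma ldual_oneE al : ldual_one R al = bcounit al.
Proof.
rewrite ldual_ofE //; split=> [x y|a x]; first exact: rb_counitD.
exact: rb_counit_tgtr.
Qed.

Lemma ldual_srcE c al : ldual_src R c al = bcounit (al ** bsrc c).
Proof.
rewrite ldual_ofE //; split=> [x y|a x].
  by rewrite mulDl (rb_counitD hR).
by rewrite /blact -mulA -(rb_src_tgt hR) mulA (rb_counit_tgtr hR).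
Qed.

Lemma ldual_tgtE a al : ldual_tgt R a al = bcounit (bsrc a ** al).
Proof.
rewrite ldual_ofE //; split=> [x y|b x].
  by rewrite mulDr (rb_counitD hR).
by rewrite /blact mulA (rb_counit_tgtr hR).
Qed.

Lemma ldual_mul_srcl c (X : D) al :
  ldual_mul (ldual_src R c) X al = X (al ** bsrc c).
Proof.
rewrite ldual_mulE -[in RHS](rb_counitr hR (al ** bsrc c)).
rewrite (rb_comul_srcr hR) (tsum_tsum _ _ _ (rb_counitr_balanced hR)) ldual_tsum.
by apply: eq_tsum => x1 x2; rewrite ldual_srcE.
Qed.

Lemma ldual_mul_tgtl a (X : D) al :
  ldual_mul (ldual_tgt R a) X al = X (bsrc a ** al).
Proof.
rewrite ldual_mulE -[in RHS](rb_counitr hR (bsrc a ** al)).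
rewrite (rb_comul_srcl hR) (tsum_tsum _ _ _ (rb_counitr_balanced hR)) ldual_tsum.
by apply: eq_tsum => x1 x2; rewrite ldual_tgtE.
Qed.

Lemma rb_counitl_balanced : balanced (fun X a => X ** bsrc a)
  (fun a X => X ** btgt a) (fun X1 X2 : R => X2 ** btgt (bcounit X1)).
Proof.
split=> [x x' y|x y y'|x c y]; last 1 first.
- by rewrite (rb_counit_srcr hR) (rb_tgtM hR) mulA.
- by rewrite (rb_counitD hR) (rb_tgtD hR) mulDr.
by rewrite mulDl.
Qed.

Lemma ldual_mul_srcr f (X : D) al :
  ldual_mul X (ldual_src R f) al = X al * f.
Proof.
rewrite ldual_mulE -[in RHS](rb_counitl hR al) ldual_tsum.
rewrite (raddf_tsum (h := *%R^~ f)) ?mul0r //; last by move=> x y; rewrite mulrDl.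
apply: eq_tsum => x1 x2; rewrite ldual_srcE !(rb_counit_srcr hR).
by rewrite ldual_tgtr.
Qed.

Lemma ldual_mul_tgtr b (X : D) al :
  ldual_mul X (ldual_tgt R b) al = X (btgt b ** al).
Proof.
rewrite ldual_mulE -[in RHS](rb_counitl hR (btgt b ** al)).
rewrite (rb_comul_tgtl hR) (tsum_tsum _ _ _ rb_counitl_balanced) ldual_tsum.
apply: eq_tsum => x1 x2; rewrite ldual_tgtE mulA (rb_counit_srcr hR).
by rewrite (rb_counit_srcl_tgtl hR) ldual_tgtr.
Qed.

Lemma ldual_bialgebroid_actE a b c f (X : ldual_bialgebroid R) al :
  (bsrc c ** (btgt a ** (X ** bsrc f ** btgt b)) : ldual_bialgebroid R) al
    = X (bsrc a ** (btgt b ** (al ** bsrc c))) * f :> A.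
Proof.
rewrite [X in _ = ldual_fun _ X * f]mulA (rb_src_tgt hR) -mulA.
rewrite [LHS]ldual_mul_srcl [LHS]ldual_mul_tgtl [LHS]ldual_mul_tgtr.
exact: ldual_mul_srcr.
Qed.

Lemma ldual_comul_balanced al be :
  balanced (fun (X : D) a => ldual_mul X (ldual_src R a))
           (fun a (Y : D) => ldual_mul Y (ldual_tgt R a))
           (fun X1 X2 => ldual_mul X2 (ldual_tgt R (X1 al)) be).
Proof.
split=> [x x' y|x y y'|x c y]; rewrite !ldual_mul_tgtr.
- by rewrite ldualDE (rb_tgtD hR) mulDl ldualD.
- by [].
by rewrite ldual_mul_srcr (rb_tgtM hR) -mulA.
Qed.

Lemma ldual_comulP (X : ldual_bialgebroid R) :
  left_fgp (@blact k A R) -> unique (ldual_comul_spec X) (bcomul X).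
Proof.
move=> [n [e [f [flin fE]]]].
pose F i : D := ldual_of _ (f i); have FE i al : F i al = f i al by rewrite ldual_ofE.
have cE i be : ldual_of (@blact k A R) (fun be => X (e i ** be)) be = X (e i ** be).
  rewrite ldual_ofE //; split=> [x y|a x]; first by rewrite mulDr ldualD.
  by rewrite /blact mulA ldual_tgtr.
have contract w : ldual_comul_spec X w ->
    w = \sum_(i < n) tens (F i) (ldual_of _ (fun be => X (e i ** be))).
  move=> wP; rewrite [LHS]tensorE.
  have tE (g m : D) : tens g m = \sum_(i < n) tens (F i) (ldual_mul m (ldual_tgt R (g (e i))))
      :> ldual_tensor R.
    under [RHS]eq_bigr => i _ do rewrite -(tens_bal (fun X a => ldual_mul X (ldual_src R a))).
    rewrite -tens_suml; congr tens; apply: ldual_eq => al.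
    rewrite [in LHS](fE al) (big_morph g (ldualD g) (ldual0 g)).
    rewrite (big_morph (fun h : D => h al) (fun h h' => ldualDE h h' al) (ldual0E _ al)).
    by apply: eq_bigr => i _; rewrite ldual_mul_srcr FE -ldual_tgtr.
  rewrite (eq_tsum _ tE) /tsum exchange_big /=; apply: eq_bigr => i _.
  rewrite -tens_sumr; congr tens; apply: ldual_eq => be.
  rewrite (big_morph (fun h : D => h be) (fun h h' => ldualDE h h' be) (ldual0E _ be)).
  by rewrite cE wP.
have ex : exists u, ldual_comul_spec X u.
  exists (\sum_(i < n) tens (F i) (ldual_of _ (fun be => X (e i ** be)))) => al be.
  rewrite (tsum_sum (ldual_comul_balanced al be)) {1}(fE al).
  rewrite (big_morph (fun Z => X (Z ** be)) (id1 := 0) (op1 := +%R)).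
  - apply: eq_bigr => i _; rewrite (tsum_tens (ldual_comul_balanced al be)).
    by rewrite ldual_mul_tgtr cE FE mulA.
  - by move=> Z Z'; rewrite mulDl ldualD.
  - by apply: (morphD0 (f := fun Z => X (Z ** be))) => Z Z'; rewrite mulDl ldualD.
split; first exact: (xgetPex 0 ex).
by move=> u /contract ->; apply: contract; exact: (xgetPex 0 ex).
Qed.

End LeftDualBialgebroidFormulas.

Section RightDualYDFormulas.
Variables (k : fieldType) (A : algType k) (R : bialgebroid_data A).
Variable G : rr_data R.
Hypotheses (hR : right_bialgebroid R) (hG : yd_right_right G).

Let mulA := rb_mulA hR.
Let mulDl := bilDl (rb_mul_bilinear hR).
Let mulDr := bilDr (rb_mul_bilinear hR).

Local Notation D := (rdual (@rr_ract k A R G)).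

Let fD (f : D) x y : f (x + y) = f x + f y.
Proof. by case: (rdualP f) => ->. Qed.
Let f0 (f : D) : f 0 = 0.
Proof. exact: morphD0 (fD f). Qed.
Let fr (f : D) x a : f (rr_ract x a) = f x * a.
Proof. by case: (rdualP f) => _ ->. Qed.
Let actDl (x y : G) (X : R) : rr_act (x + y) X = rr_act x X + rr_act y X.
Proof. by case: (rr_mod hG) => H _ _; apply: bilDl H _ _ _. Qed.
Let actDr (x : G) (X Y : R) : rr_act x (X + Y) = rr_act x X + rr_act x Y.
Proof. by case: (rr_mod hG) => H _ _; apply: bilDr H _ _ _. Qed.
Let actM (x : G) (X Y : R) : rr_act x (X ** Y) = rr_act (rr_act x X) Y.
Proof. by case: (rr_mod hG). Qed.

Lemma rr_coact_ract (x : G) b :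
  rr_coact (rr_ract x b) = \tsum_(x0, x1 <- rr_coact x) tens x0 (x1 ** bsrc b).
Proof.
have [_ H1 _ _ _] := rc_bimod (rr_comod hG).
have := rc_bilinear (rr_comod hG) 1 x b; case: (H1 (rr_ract x b)) => -> _ ->.
by apply: eq_tsum => x0 x1; rewrite (rb_src1 hR) (rb_mul1l hR).
Qed.

Lemma rdual_lactE a (f : D) x : rdual_lact a f x = a * f x.
Proof.
rewrite rdual_ofE //; split=> [y z|y b]; first by rewrite fD mulrDr.
by rewrite fr mulrA.
Qed.

Lemma rdual_ractE (f : D) a x : rdual_ract f a x = f (rr_act x (btgt a)).
Proof.
rewrite rdual_ofE //; split=> [y z|y b]; first by rewrite actDl fD.
rewrite -fr -!(rr_act_src hG) -!actM; congr (f (rr_act y _)).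
exact: (rb_src_tgt hR).
Qed.

Lemma rdual_bimodE a (f : rdual_yd G) b x :
  lr_lact a (lr_ract f b) x = a * f (rr_act x (btgt b)) :> A.
Proof. by rewrite [LHS]rdual_lactE; congr (_ * _); apply: rdual_ractE. Qed.

Lemma rdual_actE (f : D) (al : rdual_bialgebroid R) x :
  rdual_act f al x = \tsum_(x0, x1 <- rr_coact x) al (x1 ** btgt (f x0)) :> A.
Proof.
have bF : balanced (@rr_ract k A R G) (@blact k A R)
    (fun x0 x1 => al (x1 ** btgt (f x0))).
  split=> [y y' z|y z z'|y a z].
  - by rewrite fD (rb_tgtD hR) mulDr rdualD.
  - by rewrite mulDl rdualD.
  by rewrite fr (rb_tgtM hR) mulA.
rewrite rdual_ofE //; split=> [y z|y a].
  by rewrite (rc_additive (rr_comod hG)) (tsumD bF).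
rewrite rr_coact_ract (tsum_tsum _ _ _ bF) (raddf_tsum (h := *%R^~ a)).
- by apply: eq_tsum => x0 x1; rewrite -mulA (rb_src_tgt hR) mulA rdual_srcr.
- exact: mul0r.
- by move=> y' z; rewrite mulrDl.
Qed.

Lemma rdual_coact_balanced x X :
  balanced (@bract k A (rdual_bialgebroid R)) (@rdual_lact k A R G)
    (fun f1 f0 => f1 (bsrc (f0 x) ** X) : A).
Proof.
split=> [y y' z|y z z'|y a z]; first by [].
  by rewrite rdualDE (rb_srcD hR) mulDl rdualD.
by rewrite [LHS](rdual_mul_srcr hR) rdual_lactE (rb_srcM hR) -mulA.
Qed.

Lemma rdual_coactP (f : rdual_yd G) :
  right_fgp (@rr_ract k A R G) -> unique (rdual_coact_spec f) (lr_coact f).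
Proof.
move=> [n [e [h [hlin hE]]]].
pose F i : D := rdual_of _ (h i); have FE i x : F i x = h i x by rewrite rdual_ofE.
pose C i : rdual (@bract k A R) := rdual_of _ (fun X => f (rr_act (e i) X)).
have cE i X : C i X = f (rr_act (e i) X).
  rewrite rdual_ofE //; split=> [Y Z|Y a]; first by rewrite actDr fD.
  by rewrite /bract actM (rr_act_src hG) fr.
have contract w : rdual_coact_spec f w ->
    w = \sum_(i < n) tens (C i) (F i).
  move=> wP; rewrite [LHS]tensorE.
  have tE (m : rdual_bialgebroid R) (g : D) :
      tens m g = \sum_(i < n) tens (bract m (g (e i))) (F i)
      :> tensor (@bract k A (rdual_bialgebroid R)) (@rdual_lact k A R G).
    under [RHS]eq_bigr => i _ do rewrite tens_bal.
    rewrite -tens_sumr; congr tens; apply: rdual_eq => x.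
    rewrite [in LHS](hE x) (big_morph g (fD g) (f0 g)).
    rewrite (big_morph (fun h : D => h x) (fun h h' => rdualDE h h' x) (rdual0E _ x)).
    by apply: eq_bigr => i _; rewrite rdual_lactE FE -fr.
  rewrite (eq_tsum _ tE) /tsum exchange_big /=; apply: eq_bigr => i _.
  rewrite -tens_suml; congr tens; apply: rdual_eq => X.
  rewrite (big_morph (fun h : rdual (@bract k A R) => h X)
    (fun h h' => rdualDE h h' X) (rdual0E _ X)).
  by rewrite cE wP; apply: eq_bigr => p _; rewrite -(rdual_mul_srcr hR).
have ex : exists u, rdual_coact_spec f u.
  exists (\sum_(i < n) tens (C i : rdual_bialgebroid R) (F i)) => x X.
  rewrite (tsum_sum (rdual_coact_balanced x X)) {1}(hE x).
  rewrite (big_morph (fun z => f (rr_act z X)) (id1 := 0) (op1 := +%R)).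
  - apply: eq_bigr => i _; rewrite (tsum_tens (rdual_coact_balanced x X)).
    by rewrite [RHS]cE FE actM (rr_act_src hG).
  - by move=> y z; rewrite actDl fD.
  - by apply: (morphD0 (f := fun z => f (rr_act z X))) => y z; rewrite actDl fD.
split; first exact: (xgetPex 0 ex).
by move=> u /contract ->; apply: contract; exact: (xgetPex 0 ex).
Qed.

End RightDualYDFormulas.

Section LeftDualYDFormulas.
Variables (k : fieldType) (A : algType k) (R : bialgebroid_data A).
Variable T : lr_data R.
Hypotheses (hR : right_bialgebroid R) (hT : yd_left_right T).

Let mulA := rb_mulA hR.
Let mulDl := bilDl (rb_mul_bilinear hR).
Let mulDr := bilDr (rb_mul_bilinear hR).

Local Notation D := (ldual (@lr_lact k A R T)).

Let xD (x : D) f g : x (f + g) = x f + x g.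
Proof. by case: (ldualP x) => ->. Qed.
Let x0 (x : D) : x 0 = 0.
Proof. exact: morphD0 (xD x). Qed.
Let xl (x : D) a f : x (lr_lact a f) = a * x f.
Proof. by case: (ldualP x) => _ ->. Qed.
Let actDl (x y : T) (X : R) : lr_act (x + y) X = lr_act x X + lr_act y X.
Proof. by case: (lr_mod hT) => H _ _; apply: bilDl H _ _ _. Qed.
Let actDr (x : T) (X Y : R) : lr_act x (X + Y) = lr_act x X + lr_act x Y.
Proof. by case: (lr_mod hT) => H _ _; apply: bilDr H _ _ _. Qed.
Let actM (x : T) (X Y : R) : lr_act x (X ** Y) = lr_act (lr_act x X) Y.
Proof. by case: (lr_mod hT). Qed.

Lemma lr_coact_lact a (f : T) :
  lr_coact (lr_lact a f) = \tsum_(f1, f0 <- lr_coact f) tens (f1 ** btgt a) f0.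
Proof.
have [_ H1 _ _ _] := lc_bimod (lr_comod hT).
have := lc_bilinear (lr_comod hT) a f 1; case: (H1 f) => _ -> ->.
by apply: eq_tsum => f1 f0; rewrite (rb_tgt1 hR) (rb_mul1l hR).
Qed.

Lemma ldual_lactE a (x : D) f : ldual_lact a x f = x (lr_ract f a).
Proof.
have [[_ rB] _ _ _ lrA] := lc_bimod (lr_comod hT).
rewrite ldual_ofE //; split=> [g h|b g]; first by rewrite (bilDl rB) xD.
by rewrite -lrA xl.
Qed.

Lemma ldual_ractE (x : D) b f : ldual_ract x b f = x f * b.
Proof.
rewrite ldual_ofE //; split=> [g h|a g]; first by rewrite xD mulrDl.
by rewrite xl mulrA.
Qed.

Lemma ldual_actE (x : D) (X : ldual_bialgebroid R) f :
  ldual_act x X f =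
    \tsum_(f1, f0 <- lr_coact f) (bsrc (x f0) ** X : ldual_bialgebroid R) f1 :> A.
Proof.
have bF : balanced (@bract k A R) (@lr_lact k A R T)
    (fun f1 f0 => (bsrc (x f0) ** X : ldual_bialgebroid R) f1).
  split=> [y y' z|y z z'|y a z]; rewrite ?[LHS](ldual_mul_srcl hR).
  - rewrite mulDl ldualD.
    by congr (_ + _); rewrite [RHS](ldual_mul_srcl hR).
  - rewrite xD (rb_srcD hR) mulDr ldualD.
    by congr (_ + _); rewrite [RHS](ldual_mul_srcl hR).
  by rewrite [RHS](ldual_mul_srcl hR) xl (rb_srcM hR) mulA.
rewrite ldual_ofE //; split=> [y z|a y].
  by rewrite (lc_additive (lr_comod hT)) (tsumD bF).
rewrite lr_coact_lact (tsum_tsum _ _ _ bF) (raddf_tsum (h := *%R a)).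
- by apply: eq_tsum => f1 f0; rewrite -ldual_tgtr.
- exact: mulr0.
- by move=> y' z; rewrite mulrDr.
Qed.

Lemma ldual_coact_balanced f (al : R) :
  balanced (@ldual_ract k A R T) (@blact k A (ldual_bialgebroid R))
    (fun x0 x1 => (x1 ** btgt (x0 f) : ldual_bialgebroid R) al : A).
Proof.
split=> [y y' z|y z z'|y a z]; rewrite [LHS](ldual_mul_tgtr hR).
- rewrite ldualDE (rb_tgtD hR) mulDl ldualD.
  by congr (_ + _); rewrite [RHS](ldual_mul_tgtr hR).
- by rewrite ldualDE; congr (_ + _); rewrite [RHS](ldual_mul_tgtr hR).
rewrite [RHS](ldual_mul_tgtr hR) ldual_ractE (rb_tgtM hR) -mulA.
by rewrite [RHS](ldual_mul_tgtr hR).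
Qed.

Lemma ldual_coactP (x : ldual_yd T) :
  left_fgp (@lr_lact k A R T) -> unique (ldual_coact_spec x) (rr_coact x).
Proof.
move=> [n [e [h [hlin hE]]]].
pose F i : D := ldual_of _ (h i); have FE i f : F i f = h i f by rewrite ldual_ofE.
pose C i : ldual (@blact k A R) := ldual_of _ (fun al => x (lr_act (e i) al)).
have cE i al : C i al = x (lr_act (e i) al).
  rewrite ldual_ofE //; split=> [Y Z|a Y]; first by rewrite actDr xD.
  by rewrite /blact actM (lr_act_tgt hT) xl.
have contract w : ldual_coact_spec x w ->
    w = \sum_(i < n) tens (F i) (C i).
  move=> wP; rewrite [LHS]tensorE.
  have tE (g : D) (m : ldual_bialgebroid R) :
      tens g m = \sum_(i < n) tens (F i) (blact (g (e i)) m)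
      :> tensor (@ldual_ract k A R T) (@blact k A (ldual_bialgebroid R)).
    under [RHS]eq_bigr => i _ do rewrite -tens_bal.
    rewrite -tens_suml; congr tens; apply: ldual_eq => f.
    rewrite [in LHS](hE f) (big_morph g (xD g) (x0 g)).
    rewrite (big_morph (fun h : D => h f) (fun h h' => ldualDE h h' f) (ldual0E _ f)).
    by apply: eq_bigr => i _; rewrite ldual_ractE FE -xl.
  rewrite (eq_tsum _ tE) /tsum exchange_big /=; apply: eq_bigr => i _.
  rewrite -tens_sumr; congr tens; apply: ldual_eq => al.
  rewrite (big_morph (fun h : ldual (@blact k A R) => h al)
    (fun h h' => ldualDE h h' al) (ldual0E _ al)).
  by rewrite cE wP.
have ex : exists u, ldual_coact_spec x u.
  exists (\sum_(i < n) tens (F i) (C i : ldual_bialgebroid R)) => f al.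
  rewrite (tsum_sum (ldual_coact_balanced f al)) {1}(hE f).
  rewrite (big_morph (fun z => x (lr_act z al)) (id1 := 0) (op1 := +%R)).
  - apply: eq_bigr => i _; rewrite (tsum_tens (ldual_coact_balanced f al)).
    by rewrite [RHS](ldual_mul_tgtr hR) cE FE actM (lr_act_tgt hT).
  - by move=> y z; rewrite actDl xD.
  - by apply: (morphD0 (f := fun z => x (lr_act z al))) => y z; rewrite actDl xD.
split; first exact: (xgetPex 0 ex).
by move=> u /contract ->; apply: contract; exact: (xgetPex 0 ex).
Qed.

End LeftDualYDFormulas.

Section EvaluationFormulas.
Variables (k : fieldType) (A : algType k) (R : bialgebroid_data A).
Hypothesis hR : right_bialgebroid R.

Lemma bialgebroid_ev_rlE (X : R) (al : rdual_bialgebroid R) :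
  bialgebroid_ev_rl X al = al X.
Proof.
rewrite ldual_ofE //; split=> // a be.
exact: (rdual_mul_tgtr hR).
Qed.

Lemma bialgebroid_ev_lrE (al : R) (X : ldual_bialgebroid R) :
  bialgebroid_ev_lr al X = X al.
Proof.
rewrite rdual_ofE //; split=> // X' a.
exact: (ldual_mul_srcr hR).
Qed.

End EvaluationFormulas.

(* Main.v *)
Require Import Defs.
From HB Require Import structures.
From mathcomp Require Import all_boot all_algebra.
From mathcomp Require Import boolp classical_sets functions.

Set Implicit Arguments.
Unset Strict Implicit.
Unset Printing Implicit Defensive.

Import GRing.Theory.

Local Open Scope ring_scope.

(** Every operation on a dual is fixed by evaluation: products, actions and
    units are given by their values, and a coproduct or a coaction is the only
    tensor whose values on products (or on vectors acted upon) are the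
    prescribed ones.  Each axiom of the dual is an equality in a dual, or in a
    tensor product of two or three duals, and is proved by evaluating its two
    sides.

    For tensors this is where finite projectivity enters.  If [e i] and [F i]
    form a dual basis of [V], every [f] in the dual of [V] is the combination
    of the [F i] with coefficients [f (e i)].  Hence a tensor [u] in the
    product of [M] with this dual is known once its contractions, the sums of
    the [m . f x], are known ([rdual_tensor_sep], [ldual_tensor_sep]).  By
    iteration, tensors of two or three duals are known by their values
    ([rdual_tensor2_eq], [rdual_tensor3_eq] and their left counterparts).

    Once evaluated, the axioms exchange roles: associativity of the product of
    the dual, or of an action on a dual, is coassociativity downstairs;
    coassociativity of the coproduct or of the coaction is associativity
    downstairs; multiplicativity of the coproduct is that of the coproduct of
    [R], once the Takeuchi condition has moved a scalar from one tensor factor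
    to the other; and the Yetter-Drinfeld condition of the dual of [L] is that
    of [L] with the functional [x0 (x) x1 |-> (al | x1 t(f, x0))] applied to
    it, again up to the Takeuchi condition.

    As for the bidual, a dual basis makes evaluation bijective.  Evaluation
    respects the products and the actions because the two formulas that link a
    bialgebroid with its dual are exchanged when the arguments of the pairing
    are.  It respects the coproducts and the coactions because these are
    characterised by their values.

    The two halves of the theorem are mirror images: passing to the opposite
    of [A] and to the coopposite bialgebroid exchanges source and target, left
    and right, and the two factors of every tensor.  The one place where the
    mirror is imperfect is the triple tensor product, which is bracketed to the
    left: contracting a left dual in its first factor involves a rebracketing
    ([tensor_expand3]). *)

(** * Sums over tensors *)

Section TensorSums.
Variables (B : Type) (M N : zmodType) (r : M -> B -> M) (l : B -> N -> N).
Implicit Types u : tensor r l.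

Lemma tsum_bind (B' : Type) (M' N' : zmodType) (r' : M' -> B' -> M')
    (l' : B' -> N' -> N') (v : tensor r' l') (T : M' -> N' -> tensor r l)
    (G : zmodType) (F : M -> N -> G) :
  balanced r l F ->
  tsum (tsum v T) F = \tsum_(x, y <- v) tsum (T x y) F.
Proof. by move=> bF; apply: tsum_sum. Qed.

Lemma exchange_tsum (B' : Type) (M' N' : zmodType) (r' : M' -> B' -> M')
    (l' : B' -> N' -> N') u (v : tensor r' l') (G : zmodType)
    (F : M -> N -> M' -> N' -> G) :
  \tsum_(x, y <- u) \tsum_(x', y' <- v) F x y x' y' =
  \tsum_(x', y' <- v) \tsum_(x, y <- u) F x y x' y'.
Proof. exact: exchange_big. Qed.

Lemma tsum_split (G : zmodType) (F F' : M -> N -> G) u :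
  \tsum_(x, y <- u) (F x y + F' x y) = tsum u F + tsum u F'.
Proof. exact: big_split. Qed.

Lemma morph_tsum (G H : zmodType) (h : G -> H) (F : M -> N -> G) u :
  {morph h : x y / x + y} -> h (tsum u F) = \tsum_(x, y <- u) h (F x y).
Proof. by move=> hD; apply: raddf_tsum (morphD0 hD) hD. Qed.

Lemma balanced_comp (G H : zmodType) (h : G -> H) (F : M -> N -> G) :
  {morph h : x y / x + y} -> balanced r l F ->
  balanced r l (fun x y => h (F x y)).
Proof.
move=> hD [Fl Fr Fa].
by split=> [x x' y|x y y'|x a y]; rewrite ?Fl ?Fr ?hD ?Fa.
Qed.

(** The coefficients of an expansion of the second factors cross the tensor
    sign, so that only the vectors [e i] remain there. *)
Lemma tensor_expandr n (e : 'I_n -> N) (f : 'I_n -> N -> B) :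
  (forall y, y = \sum_(i < n) l (f i y) (e i)) ->
  forall u, u = \sum_(i < n) tens (\tsum_(x, y <- u) r x (f i y)) (e i).
Proof.
move=> eP u; rewrite [LHS]tensorE.
under [RHS]eq_bigr do rewrite /tsum tens_suml.
rewrite exchange_big; apply: eq_bigr => p _ /=.
rewrite {1}(eP p.2) tens_sumr; apply: eq_bigr => i _.
by rewrite tens_bal.
Qed.

Lemma tensor_expandl n (e : 'I_n -> M) (f : 'I_n -> M -> B) :
  (forall x, x = \sum_(i < n) r (e i) (f i x)) ->
  forall u, u = \sum_(i < n) tens (e i) (\tsum_(x, y <- u) l (f i x) y).
Proof.
move=> eP u; rewrite [LHS]tensorE.
under [RHS]eq_bigr do rewrite /tsum tens_sumr.
rewrite exchange_big; apply: eq_bigr => p _ /=.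
rewrite {1}(eP p.1) tens_suml; apply: eq_bigr => i _.
by rewrite tens_bal.
Qed.

End TensorSums.

Section TripleTensor.
Variables (B : Type) (M N P : zmodType) (r1 : M -> B -> M) (l2 : B -> N -> N).
Variables (r2 : N -> B -> N) (l3 : B -> P -> P).

(** What [K] has to satisfy to induce a map on the triple tensor product, the
    middle factor being acted upon from both sides. *)
Definition tribalanced (G : zmodType) (K : M -> N -> P -> G) : Prop :=
  (forall z, balanced r1 l2 (fun x y => K x y z)) /\
  (forall x, balanced r2 l3 (K x)).

(** [tensor_ract] acts on the middle factors of a representative; summing over
    that representative turns its action into the action [r2] on the second
    argument of [K]. *)
Lemma tribalanced_tsum (G : zmodType) (K : M -> N -> P -> G) :
  tribalanced K ->
  balanced (@tensor_ract B M N r1 l2 B r2) l3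
    (fun w z => \tsum_(x, y <- w) K x y z).
Proof.
move=> [K1 K2]; split=> [w w' z|w z z'|w b z].
- exact: (tsumD (K1 z)).
- rewrite -tsum_split; apply: eq_tsum => x y.
  by case: (K2 x) => _ -> _.
rewrite (tsum_bind _ _ (K1 z)); apply: eq_tsum => x y.
by rewrite (tsum_tens (K1 z)); case: (K2 x) => _ _ ->.
Qed.

(** A coassociativity axiom is an equality in a triple tensor product; this is
    the form in which it gets used, a function of the three Sweedler factors
    being applied to both sides.  With [p] and [q] two distinct maps it covers
    coactions, on either side, as well as coproducts. *)
Lemma coassoc_sum (B' : Type) (r0 : M -> B' -> M) (l0 : B' -> P -> P)
    (u : tensor r0 l0) (p : M -> tensor r1 l2) (q : P -> tensor r2 l3)
    (G : zmodType) (K : M -> N -> P -> G) :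
  tribalanced K ->
  \tsum_(x, z <- u) tens (p x) z =
  \tsum_(x, z <- u) \tsum_(y, t <- q z) tens (tens x y) t
    :> tensor (@tensor_ract B M N r1 l2 B r2) l3 ->
  \tsum_(x, z <- u) \tsum_(y, t <- p x) K y t z =
  \tsum_(x, z <- u) \tsum_(y, t <- q z) K x y t.
Proof.
move=> KP /(congr1 (fun w => tsum w (fun v z => \tsum_(x, y <- v) K x y z))).
have bK := tribalanced_tsum KP.
rewrite (tsum_tsum _ _ _ bK) (tsum_bind _ _ bK) => ->.
apply: eq_tsum => x z; rewrite (tsum_tsum _ _ _ bK).
by apply: eq_tsum => y t; rewrite (tsum_tens (KP.1 _)).
Qed.

Hypothesis r2D : forall b, {morph r2^~ b : y y' / y + y'}.
Hypothesis l2r2 : forall a y b, l2 a (r2 y b) = r2 (l2 a y) b.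

Lemma tensor_ract_tens x y b :
  @tensor_ract B M N r1 l2 B r2 (tens x y) b = tens x (r2 y b).
Proof.
rewrite /tensor_ract tsum_tens //.
split=> [x' x'' y'|x' y' y''|x' a y']; first exact: tensDl.
  by rewrite r2D tensDr.
by rewrite tens_bal l2r2.
Qed.

(** Since the triple product is bracketed to the left, the coefficients of an
    expansion of the first factor cross a tensor sign inside the bracket; what
    they multiply is a tensor of the last two factors. *)
Lemma tensor_expand3 n (e : 'I_n -> M) (f : 'I_n -> M -> B)
    (u : tensor (@tensor_ract B M N r1 l2 B r2) l3) :
  (forall x, x = \sum_(i < n) r1 (e i) (f i x)) ->
  u = \sum_(i < n) \tsum_(y, z <- \tsum_(w, z <- u)
         tens (\tsum_(x, y <- w) l2 (f i x) y) z : tensor r2 l3)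
       tens (tens (e i) y) z.
Proof.
move=> eP; rewrite [LHS]tensorE.
have bal i : balanced r2 l3 (fun y z =>
    tens (tens (e i) y) z : tensor (@tensor_ract B M N r1 l2 B r2) l3).
  split=> [y y' z|y z z'|y b z]; rewrite ?tensDr ?tensDl //.
  by rewrite -tens_bal tensor_ract_tens.
under [RHS]eq_bigr => i _ do rewrite (tsum_tsum _ _ _ (bal i)).
rewrite exchange_big; apply: eq_bigr => p _ /=.
by rewrite {1}(tensor_expandl eP p.1) tens_suml.
Qed.

End TripleTensor.

(** * Duals of finitely generated projective modules *)

Section LinearityFromA.
Variables (k : fieldType) (A : algType k).

Lemma bilZl (U V W : lmodType k) (f : U -> V -> W) (fB : bilinear_map f) c x y :
  f (c *: x) y = c *: f x y.
Proof.
have f0 : f 0 y = 0 by apply: morphD0 (f^~ y) (fun x x' => bilDl fB x x' y).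
by case: fB => H _; rewrite -[c *: x]addr0 H f0 addr0.
Qed.

Lemma bilZr (U V W : lmodType k) (f : U -> V -> W) (fB : bilinear_map f) c x y :
  f x (c *: y) = c *: f x y.
Proof.
have f0 : f x 0 = 0 by apply: morphD0 (bilDr fB x).
by case: fB => _ H; rewrite -[c *: y]addr0 H f0 addr0.
Qed.

(** Scalars of [k] act through [A], because [c *: v] is [r v (c *: 1)]. *)
Lemma rdualZ (V : lmodType k) (r : V -> A -> V) (f : rdual r) :
  bilinear_map r -> (forall v, r v 1 = v) ->
  forall c v, f (c *: v) = c *: f v.
Proof.
move=> rB r1 c v; rewrite -[in LHS](r1 v) -(bilZr rB).
by case: (rdualP f) => _ ->; rewrite -scalerAr mulr1.
Qed.

Lemma ldualZ (V : lmodType k) (l : A -> V -> V) (f : ldual l) :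
  bilinear_map l -> (forall v, l 1 v = v) ->
  forall c v, f (c *: v) = c *: f v.
Proof.
move=> lB l1 c v; rewrite -[in LHS](l1 v) -(bilZl lB).
by case: (ldualP f) => _ ->; rewrite -scalerAl mul1r.
Qed.

Lemma tsum_linear (B : Type) (M N : zmodType) (r : M -> B -> M)
    (l : B -> N -> N) (u : tensor r l) (G : lmodType k) c (F F' : M -> N -> G) :
  \tsum_(x, y <- u) (c *: F x y + F' x y) = c *: tsum u F + tsum u F'.
Proof. by rewrite tsum_split scaler_sumr. Qed.

End LinearityFromA.

Section DualSeparation.
Variables (k : fieldType) (A : algType k) (V : lmodType k).

Lemma rdual_basis (r : V -> A -> V) : right_fgp r ->
  exists n (e : 'I_n -> V) (F : 'I_n -> rdual r),
    forall x, x = \sum_(i < n) r (e i) (F i x).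
Proof.
move=> [n [e [f [fP eP]]]]; exists n, e, (fun i => rdual_of r (f i)) => x.
by rewrite {1}(eP x); apply: eq_bigr => i _; rewrite rdual_ofE.
Qed.

Lemma ldual_basis (l : A -> V -> V) : left_fgp l ->
  exists n (e : 'I_n -> V) (F : 'I_n -> ldual l),
    forall x, x = \sum_(i < n) l (F i x) (e i).
Proof.
move=> [n [e [f [fP eP]]]]; exists n, e, (fun i => ldual_of l (f i)) => x.
by rewrite {1}(eP x); apply: eq_bigr => i _; rewrite ldual_ofE.
Qed.

Lemma rdual_sumE (r : V -> A -> V) (I : Type) (s : seq I) (F : I -> rdual r) x :
  (\sum_(i <- s) F i) x = \sum_(i <- s) F i x.
Proof.
exact: (big_morph (fun f : rdual r => f x) (fun f g => rdualDE f g x)).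
Qed.

Lemma ldual_sumE (l : A -> V -> V) (I : Type) (s : seq I) (F : I -> ldual l) x :
  (\sum_(i <- s) F i) x = \sum_(i <- s) F i x.
Proof.
exact: (big_morph (fun f : ldual l => f x) (fun f g => ldualDE f g x)).
Qed.

Lemma rdual_sum (r : V -> A -> V) (f : rdual r) (I : Type) (s : seq I)
    (F : I -> V) :
  f (\sum_(i <- s) F i) = \sum_(i <- s) f (F i).
Proof. by case: (rdualP f) => fD _; apply: (big_morph f fD (morphD0 fD)). Qed.

Lemma ldual_sum (l : A -> V -> V) (f : ldual l) (I : Type) (s : seq I)
    (F : I -> V) :
  f (\sum_(i <- s) F i) = \sum_(i <- s) f (F i).
Proof. by case: (ldualP f) => fD _; apply: (big_morph f fD (morphD0 fD)). Qed.

(** The vectors [e i], as evaluations, are coordinates along the [F i]: a dual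
    basis of [V] is one of its dual with the two families exchanged. *)
Lemma rdual_expand (r : V -> A -> V) (l : A -> rdual r -> rdual r)
    n (e : 'I_n -> V) (F : 'I_n -> rdual r) :
  (forall a f x, l a f x = a * f x) ->
  (forall x, x = \sum_(i < n) r (e i) (F i x)) ->
  forall f : rdual r, f = \sum_(i < n) l (f (e i)) (F i).
Proof.
move=> lE eP f; apply: rdual_eq => x; rewrite rdual_sumE {1}(eP x) rdual_sum.
by apply: eq_bigr => i _; rewrite lE; case: (rdualP f) => _ ->.
Qed.

Lemma ldual_expand (l : A -> V -> V) (r : ldual l -> A -> ldual l)
    n (e : 'I_n -> V) (F : 'I_n -> ldual l) :
  (forall f a x, r f a x = f x * a) ->
  (forall x, x = \sum_(i < n) l (F i x) (e i)) ->
  forall f : ldual l, f = \sum_(i < n) r (F i) (f (e i)).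
Proof.
move=> rE eP f; apply: ldual_eq => x; rewrite ldual_sumE {1}(eP x) ldual_sum.
by apply: eq_bigr => i _; rewrite rE; case: (ldualP f) => _ ->.
Qed.

Lemma rdual_left_fgp (r : V -> A -> V) (l : A -> rdual r -> rdual r) :
  right_fgp r -> (forall a f x, l a f x = a * f x) -> left_fgp l.
Proof.
move=> /rdual_basis[n [e [F eP]]] lE.
exists n, F, (fun i (f : rdual r) => f (e i)).
by split; [split=> // a f; apply: lE | apply: rdual_expand eP].
Qed.

Lemma ldual_right_fgp (l : A -> V -> V) (r : ldual l -> A -> ldual l) :
  left_fgp l -> (forall f a x, r f a x = f x * a) -> right_fgp r.
Proof.
move=> /ldual_basis[n [e [F eP]]] rE.
exists n, F, (fun i (f : ldual l) => f (e i)).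
by split; [split=> // f a; apply: rE | apply: ldual_expand eP].
Qed.

(** After expansion of the second factor along the [F i], the coefficients are
    the contractions at the [e i]. *)
Lemma rdual_tensor_sep (r : V -> A -> V) (l : A -> rdual r -> rdual r)
    (M : zmodType) (rM : M -> A -> M) (u v : tensor rM l) :
  right_fgp r -> (forall a f x, l a f x = a * f x) ->
  (forall x, \tsum_(m, f <- u) rM m (f x) = \tsum_(m, f <- v) rM m (f x)) ->
  u = v.
Proof.
move=> /rdual_basis[n [e [F eP]]] lE uv.
rewrite (tensor_expandr (rdual_expand lE eP) u).
rewrite [RHS](tensor_expandr (rdual_expand lE eP)).
by apply: eq_bigr => i _; rewrite uv.
Qed.

Lemma ldual_tensor_sep (l : A -> V -> V) (r : ldual l -> A -> ldual l)
    (N : zmodType) (lN : A -> N -> N) (u v : tensor r lN) :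
  left_fgp l -> (forall f a x, r f a x = f x * a) ->
  (forall x, \tsum_(f, y <- u) lN (f x) y = \tsum_(f, y <- v) lN (f x) y) ->
  u = v.
Proof.
move=> /ldual_basis[n [e [F eP]]] rE uv.
rewrite (tensor_expandl (ldual_expand rE eP) u).
rewrite [RHS](tensor_expandl (ldual_expand rE eP)).
by apply: eq_bigr => i _; rewrite uv.
Qed.

Lemma ldual_tensor3_sep (l : A -> V -> V) (r : ldual l -> A -> ldual l)
    (N P : zmodType) (lN : A -> N -> N) (rN : N -> A -> N) (lP : A -> P -> P)
    (u v : tensor (@tensor_ract A (ldual l) N r lN A rN) lP) :
  (forall b, {morph rN^~ b : y y' / y + y'}) ->
  (forall a y b, lN a (rN y b) = rN (lN a y) b) ->
  left_fgp l -> (forall f a x, r f a x = f x * a) ->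
  (forall x,
     \tsum_(w, z <- u) tens (\tsum_(f, y <- w) lN (f x) y) z =
     \tsum_(w, z <- v) tens (\tsum_(f, y <- w) lN (f x) y) z
     :> tensor rN lP) ->
  u = v.
Proof.
move=> rD lr /ldual_basis[n [e [F eP]]] rE uv.
rewrite (tensor_expand3 rD lr u (ldual_expand rE eP)).
rewrite [RHS](tensor_expand3 rD lr v (ldual_expand rE eP)).
by apply: eq_bigr => i _; rewrite uv.
Qed.

End DualSeparation.

Section BidualBijection.
Variables (k : fieldType) (A : algType k) (V : lmodType k).

(** The inverse sends [phi] to the vector whose coordinates along the [e i] are
    the [phi (F i)]. *)
Lemma rdual_bidual_bij (r : V -> A -> V)
    (l : A -> rdual r -> rdual r) (h : V -> ldual l) :
  right_fgp r -> (forall a f x, l a f x = a * f x) ->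
  (forall x (f : rdual r), h x f = f x) -> bijective h.
Proof.
move=> /rdual_basis[n [e [F eP]]] lE hE.
exists (fun phi : ldual l => \sum_(i < n) r (e i) (phi (F i))) => [x|phi].
  by rewrite [RHS]eP; apply: eq_bigr => i _; rewrite hE.
apply: ldual_eq => f; rewrite hE rdual_sum.
rewrite [in RHS](rdual_expand lE eP f) ldual_sum; apply: eq_bigr => i _.
by case: (rdualP f) => _ ->; case: (ldualP phi) => _ ->.
Qed.

Lemma ldual_bidual_bij (l : A -> V -> V)
    (r : ldual l -> A -> ldual l) (h : V -> rdual r) :
  left_fgp l -> (forall f a x, r f a x = f x * a) ->
  (forall x (f : ldual l), h x f = f x) -> bijective h.
Proof.
move=> /ldual_basis[n [e [F eP]]] lE hE.
exists (fun phi : rdual r => \sum_(i < n) l (phi (F i)) (e i)) => [x|phi].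
  by rewrite [RHS]eP; apply: eq_bigr => i _; rewrite hE.
apply: rdual_eq => f; rewrite hE ldual_sum.
rewrite [in RHS](ldual_expand lE eP f) rdual_sum; apply: eq_bigr => i _.
by case: (ldualP f) => _ ->; case: (rdualP phi) => _ ->.
Qed.

End BidualBijection.

(** * Coassociativity and the Takeuchi condition in a bialgebroid *)

Section BialgebroidTools.
Variables (k : fieldType) (A : algType k) (R : bialgebroid_data A).
Hypothesis hR : right_bialgebroid R.

Lemma bract1 (X : R) : bract X 1 = X.
Proof. by rewrite /bract (rb_src1 hR) (rb_mul1r hR). Qed.

Lemma blact1 (X : R) : blact 1 X = X.
Proof. by rewrite /blact (rb_tgt1 hR) (rb_mul1r hR). Qed.

Lemma bract_bilinear : bilinear_map (@bract k A R).
Proof.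
case: (rb_mul_bilinear hR) => ml mr; split=> [a|X] c x y; first exact: ml.
by rewrite /bract; case: (rb_src hR) => -> _ _; rewrite mr.
Qed.

Lemma blact_bilinear : bilinear_map (@blact k A R).
Proof.
case: (rb_mul_bilinear hR) => ml mr; split=> [X|a] c x y; last exact: ml.
by rewrite /blact; case: (rb_tgt hR) => -> _ _; rewrite mr.
Qed.

Lemma rb_coassoc_sum (G : zmodType) (K : R -> R -> R -> G) X :
  tribalanced (@bract k A R) (@blact k A R) (@bract k A R) (@blact k A R) K ->
  \tsum_(X1, X2 <- bcomul X) \tsum_(Y1, Y2 <- bcomul X1) K Y1 Y2 X2 =
  \tsum_(X1, X2 <- bcomul X) \tsum_(Y1, Y2 <- bcomul X2) K X1 Y1 Y2.
Proof. by move=> KP; apply: coassoc_sum KP (rb_coassoc hR X). Qed.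

Lemma rb_takeuchi_sum (G : zmodType) (F : R -> R -> G) a X :
  balanced (@bract k A R) (@blact k A R) F ->
  \tsum_(X1, X2 <- bcomul X) F (bsrc a ** X1) X2 =
  \tsum_(X1, X2 <- bcomul X) F X1 (btgt a ** X2).
Proof.
move=> bF; have := congr1 (fun u => tsum u F) (rb_takeuchi hR a X).
by rewrite !(tsum_tsum _ _ _ bF).
Qed.

End BialgebroidTools.

(** * Evaluation of tensors of right duals *)

Section RightDualSeparation.
Variables (k : fieldType) (A : algType k) (R : bialgebroid_data A).
Hypothesis hR : right_bialgebroid R.
Hypothesis fR : right_fgp (@bract k A R).

Let mulA := rb_mulA hR.
Let mulDl := bilDl (rb_mul_bilinear hR).
Let mulDr := bilDr (rb_mul_bilinear hR).

Local Notation D := (rdual_bialgebroid R).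
Local Notation ev := (@rdual_fun k A R (@bract k A R)).

Lemma rdual_bialgebroid_eq (al be : D) : ev al =1 ev be -> al = be.
Proof. exact: rdual_eq. Qed.

Lemma rdual_evM (al be : D) X :
  ev (al ** be) X = \tsum_(X1, X2 <- bcomul X) ev be (X2 ** btgt (ev al X1)).
Proof. exact: rdual_mulE. Qed.

Lemma rdual_ev_srcl a (al : D) X : ev (bsrc a ** al) X = ev al (btgt a ** X).
Proof. exact: rdual_mul_srcl. Qed.

Lemma rdual_ev_tgtl b (al : D) X : ev (btgt b ** al) X = ev al (X ** btgt b).
Proof. exact: rdual_mul_tgtl. Qed.

Lemma rdual_ev_srcr c (al : D) X : ev (al ** bsrc c) X = ev al (bsrc c ** X).
Proof. exact: rdual_mul_srcr. Qed.

Lemma rdual_ev_tgtr d (al : D) X : ev (al ** btgt d) X = d * ev al X.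
Proof. exact: rdual_mul_tgtr. Qed.

Lemma rdual_ev_bract (al : D) c X : ev (bract al c) X = ev al (bsrc c ** X).
Proof. exact: rdual_ev_srcr. Qed.

Lemma rdual_ev_blact d (al : D) X : ev (blact d al) X = d * ev al X.
Proof. exact: rdual_ev_tgtr. Qed.

Lemma rdual_ev_src_additive (al : D) Y :
  {morph (fun a => ev al (bsrc a ** Y)) : a b / a + b}.
Proof. by move=> a b; rewrite (rb_srcD hR) mulDl rdualD. Qed.

Lemma rdual_ev_tgt_additive (al : D) Y :
  {morph (fun a => ev al (Y ** btgt a)) : a b / a + b}.
Proof. by move=> a b; rewrite (rb_tgtD hR) mulDr rdualD. Qed.

(** The function to which the Takeuchi condition is applied, for the
    multiplicativity of the coproduct of the dual and for its Yetter-Drinfeld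
    condition. *)
Lemma rdual_mul_mull_balanced (al be : D) X :
  balanced (@bract k A R) (@blact k A R)
    (fun Y1 Y2 => ev be (X ** Y2 ** btgt (ev al Y1))).
Proof.
split=> [Y1 Y1' Y2|Y1 Y2 Y2'|Y1 a Y2].
- by rewrite rdualD (rb_tgtD hR) mulDr rdualD.
- by rewrite mulDr mulDl rdualD.
by rewrite rdual_srcr (rb_tgtM hR) !mulA.
Qed.

(** Half of what coassociativity needs in order to give the associativity of
    the product and of the action of the dual; [b] stands for a value at the
    first of three Sweedler factors. *)
Lemma rdual_mul_tgt_balanced (al be : D) b :
  balanced (@bract k A R) (@blact k A R)
    (fun X1 X2 => ev be (X2 ** btgt (ev al (X1 ** btgt b)))).
Proof.
split=> [X1 X1' X2|X1 X2 X2'|X1 a X2].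
- by rewrite mulDl rdualD rdual_ev_tgt_additive.
- by rewrite mulDl rdualD.
by rewrite /bract /blact -mulA (rb_src_tgt hR) mulA rdual_srcr (rb_tgtM hR) mulA.
Qed.

Section WithModule.
Variables (V : lmodType k) (r : V -> A -> V) (l : A -> rdual r -> rdual r).
Hypothesis lE : forall a f x, l a f x = a * f x.

(** The values of a tensor of [D] with the dual of [V], where [V] is [R] when
    coproducts are compared, and a Yetter-Drinfeld module for coactions. *)
Lemma rdual_pair_balanced x Y :
  balanced (@bract k A D) l (fun al f => ev al (bsrc (f x) ** Y)).
Proof.
split=> [al al' f|al f f'|al c f]; first by [].
  by rewrite rdualDE (rb_srcD hR) mulDl rdualD.
by rewrite rdual_ev_bract lE (rb_srcM hR) mulA.
Qed.

Lemma rdual_triple_tribalanced x Y Z :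
  tribalanced (@bract k A D) (@blact k A D) (@bract k A D) l
   (fun al be f => ev al (bsrc (ev be (bsrc (f x) ** Y)) ** Z)).
Proof.
split=> [f|al].
  split=> [al al' be|al be be'|al c be]; first by [].
    by rewrite rdualDE (rb_srcD hR) mulDl rdualD.
  by rewrite rdual_ev_bract rdual_ev_blact (rb_srcM hR) mulA.
exact: balanced_comp (rdual_ev_src_additive al Z) (rdual_pair_balanced x Y).
Qed.

Hypothesis fr : right_fgp r.

(** Contraction at [x] leaves an equality in [D], to be tested at [Y]. *)
Lemma rdual_tensor2_eq (u v : tensor (@bract k A D) l) :
  (forall x Y, \tsum_(al, f <- u) ev al (bsrc (f x) ** Y) =
               \tsum_(al, f <- v) ev al (bsrc (f x) ** Y)) -> u = v.
Proof.
move=> uv; apply: (rdual_tensor_sep fr lE) => x.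
apply: rdual_bialgebroid_eq => Y.
rewrite !(morph_tsum (h := fun al : D => ev al Y)) //.
under eq_tsum do rewrite rdual_ev_bract.
by under [RHS]eq_tsum do rewrite rdual_ev_bract.
Qed.

End WithModule.

(** Contraction of the last factor at [x] leaves an equality in [D (x) D]; the
    coefficient [f x] acts on the middle factor from the right, which means
    that it multiplies its argument by a source. *)
Lemma rdual_tensor3_eq (V : lmodType k) (r : V -> A -> V)
    (l : A -> rdual r -> rdual r)
    (u v : tensor (@tensor_ract A D D (@bract k A D) (@blact k A D)
                     A (@bract k A D)) l) :
  (forall a f x, l a f x = a * f x) -> right_fgp r ->
  (forall x Y Z,
     \tsum_(w, f <- u) \tsum_(al, be <- w)
        ev al (bsrc (ev be (bsrc (f x) ** Y)) ** Z) =
     \tsum_(w, f <- v) \tsum_(al, be <- w)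
        ev al (bsrc (ev be (bsrc (f x) ** Y)) ** Z)) -> u = v.
Proof.
move=> lE fr uv; apply: (rdual_tensor_sep fr lE) => x.
have lDE a (f : D) X : ev (blact a f) X = a * ev f X by exact: rdual_ev_blact.
apply: (rdual_tensor2_eq lDE fR) => Y Z.
have bal := rdual_pair_balanced lDE Y Z.
rewrite !(tsum_bind _ _ bal) /tensor_ract.
have e (w : tensor (@bract k A D) (@blact k A D)) a :
  tsum (\tsum_(al, be <- w) tens al (bract be a)
          : tensor (@bract k A D) (@blact k A D))
    (fun al be => ev al (bsrc (ev be Y) ** Z))
  = \tsum_(al, be <- w) ev al (bsrc (ev be (bsrc a ** Y)) ** Z).
  rewrite (tsum_tsum _ _ _ bal); apply: eq_tsum => al be.
  by rewrite rdual_ev_bract.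
under eq_tsum do rewrite e.
by under [RHS]eq_tsum do rewrite e.
Qed.

End RightDualSeparation.

(** * The right dual of a bialgebroid *)

Section RightDualBialgebroid.
Variables (k : fieldType) (A : algType k) (R : bialgebroid_data A).
Hypothesis hR : right_bialgebroid R.
Hypothesis fR : right_fgp (@bract k A R).

Let mulA := rb_mulA hR.
Let mulDl := bilDl (rb_mul_bilinear hR).
Let mulDr := bilDr (rb_mul_bilinear hR).

Local Notation D := (rdual_bialgebroid R).
Local Notation ev := (@rdual_fun k A R (@bract k A R)).

Let evZ (al : D) c X : ev al (c *: X) = c *: ev al X.
Proof. exact: rdualZ (bract_bilinear hR) (bract1 hR) c X. Qed.

Let evs := (rdual_ev_srcl hR, rdual_ev_tgtl hR, rdual_ev_srcr hR,
  rdual_ev_tgtr hR, rdual_ev_bract hR, rdual_ev_blact hR).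

Let mul_balanced (al be : D) := rdual_mul_balanced hR al be.

Let pair_balanced := rdual_pair_balanced hR (rdual_ev_blact hR).

Lemma rdual_ev_one X : ev (bone : D) X = bcounit X.
Proof. exact: rdual_oneE. Qed.

Lemma rdual_ev_src a X : ev (bsrc a : D) X = bcounit (btgt a ** X).
Proof. exact: rdual_srcE. Qed.

Lemma rdual_ev_tgt a X : ev (btgt a : D) X = bcounit (X ** btgt a).
Proof. exact: rdual_tgtE. Qed.

Lemma rdual_ev_comul (al : D) X Y :
  \tsum_(al1, al2 <- bcomul al) ev al1 (bsrc (ev al2 X) ** Y) = ev al (X ** Y).
Proof. by have [<- _] := rdual_comulP hR al fR. Qed.

Lemma rdual_mul_bilinear : bilinear_map (@bmul k A D).
Proof.
split=> [be|al] c x y; apply: rdual_bialgebroid_eq => X.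
  rewrite rdualDE rdualZE !(rdual_evM hR) -tsum_linear.
  apply: eq_tsum => X1 X2; rewrite rdualDE rdualZE.
  by case: (rb_tgt hR) => -> _ _; rewrite mulDr (bilZr (rb_mul_bilinear hR)) rdualD evZ.
rewrite rdualDE rdualZE !(rdual_evM hR) -tsum_linear.
by apply: eq_tsum => X1 X2; rewrite rdualDE rdualZE.
Qed.

(** Both sides are values of one function of three Sweedler factors of the
    argument, for the two ways of splitting it. *)
Lemma rdual_mulA : associative (@bmul k A D).
Proof.
move=> al be ga; apply: rdual_bialgebroid_eq => X.
have tri : tribalanced (@bract k A R) (@blact k A R) (@bract k A R) (@blact k A R)
  (fun X1 X2 X3 => ev ga (X3 ** btgt (ev be (X2 ** btgt (ev al X1))))).
  split=> [Z|Y]; last exact: rdual_mul_tgt_balanced.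
  exact: balanced_comp (rdual_ev_tgt_additive hR ga Z) (mul_balanced al be).
rewrite !(rdual_evM hR).
under eq_tsum => X1 X2.
  rewrite (rdual_evM hR) (rb_comul_tgtr hR) (tsum_tsum _ _ _ (mul_balanced be ga)).
  over.
rewrite -(rb_coassoc_sum hR X tri); apply: eq_tsum => X1 X2.
by rewrite (rdual_evM hR) (morph_tsum _ _ (rdual_ev_tgt_additive hR ga X2)).
Qed.

Lemma rdual_comulD : {morph @bcomul k A D : al be / al + be}.
Proof.
move=> al be; apply: (rdual_tensor2_eq hR (rdual_ev_blact hR) fR) => X Y.
by rewrite (tsumD (pair_balanced X Y)) !rdual_ev_comul rdualDE.
Qed.

(** Both sides take at [X], [Y], [Z] the value of [al] at the triple product,
    with its two bracketings. *)
Lemma rdual_coassoc (al : D) :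
  \tsum_(al1, al2 <- bcomul al) tens (bcomul al1) al2 =
  \tsum_(al1, al2 <- bcomul al) \tsum_(be1, be2 <- bcomul al2)
     tens (tens al1 be1) be2
  :> tensor (tensor_ract (@bract k A D)) (@blact k A D).
Proof.
have lE := rdual_ev_blact hR.
apply: (rdual_tensor3_eq hR fR lE fR) => X Y Z.
have tri := rdual_triple_tribalanced hR lE X Y Z.
have bal := tribalanced_tsum tri.
rewrite (tsum_tsum _ _ _ bal) (tsum_bind _ _ bal).
under eq_tsum do rewrite rdual_ev_comul -mulA.
rewrite rdual_ev_comul mulA -rdual_ev_comul; apply: eq_tsum => al1 al2.
rewrite (tsum_tsum _ _ _ bal) -(rdual_ev_comul al2).
rewrite (morph_tsum _ _ (rdual_ev_src_additive hR al1 Z)); apply: eq_tsum => be1 be2.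
by rewrite (tsum_tens (tri.1 be2)).
Qed.

(** Both sides become sums of values of [be], in which the value of [al2] at
    [X1] appears as a target in front of [Y2] for one of them.  The Takeuchi
    condition makes it a source in front of [Y1], where the factors of [al]
    recombine into the value of [al] at [X1 ** Y1]. *)
Lemma rdual_comul_mul (al be : D) : bcomul (al ** be) =
  \tsum_(al1, al2 <- bcomul al) \tsum_(be1, be2 <- bcomul be)
     tens (al1 ** be1) (al2 ** be2).
Proof.
apply: (rdual_tensor2_eq hR (rdual_ev_blact hR) fR) => X Y.
rewrite (tsum_bind _ _ (pair_balanced X Y)) rdual_ev_comul (rdual_evM hR).
have bm := mul_balanced al be.
rewrite (rb_comul_mul hR) (tsum_bind _ _ bm).
transitivity (\tsum_(X1, X2 <- bcomul X) \tsum_(Y1, Y2 <- bcomul Y)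
  \tsum_(al1, al2 <- bcomul al)
    ev be (X2 ** btgt (ev al2 X1) ** (Y2 ** btgt (ev al1 Y1)))).
  apply: eq_tsum => X1 X2; rewrite (tsum_tsum _ _ _ bm).
  transitivity (\tsum_(Y1, Y2 <- bcomul Y) \tsum_(al1, al2 <- bcomul al)
      ev be (X2 ** Y2 ** btgt (ev al1 (bsrc (ev al2 X1) ** Y1)))).
    apply: eq_tsum => Y1 Y2; rewrite -(rdual_ev_comul al).
    exact: (morph_tsum _ _ (rdual_ev_tgt_additive hR be _)).
  rewrite exchange_tsum [RHS]exchange_tsum; apply: eq_tsum => al1 al2.
  rewrite (rb_takeuchi_sum hR _ _ (rdual_mul_mull_balanced hR al1 be X2)).
  by apply: eq_tsum => Y1 Y2; rewrite !mulA.
under eq_tsum => X1 X2 do rewrite exchange_tsum.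
rewrite exchange_tsum; apply: eq_tsum => al1 al2.
rewrite (tsum_tsum _ _ _ (pair_balanced X Y)).
under [RHS]eq_tsum => be1 be2.
  rewrite !(rdual_evM hR) (rb_comul_srcl hR) (tsum_tsum _ _ _ (mul_balanced al1 be1)).
  under eq_tsum => Y1 Y2.
    rewrite -mulA (morph_tsum _ _ (rdual_ev_src_additive hR be1 _)); over.
  over.
rewrite exchange_tsum [RHS]exchange_tsum; apply: eq_tsum => Y1 Y2.
rewrite [RHS]exchange_tsum; apply: eq_tsum => X1 X2.
by rewrite -rdual_ev_comul.
Qed.

(** The source and the target of the dual act by translation of the argument,
    which reduces the axioms about them to the bialgebroid axioms of [R]; the
    counit axioms come from evaluating [al] at products with the unit. *)
Lemma rdual_right_bialgebroid : right_bialgebroid D.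
Proof.
have m1l := rb_mul1l hR; have m1r := rb_mul1r hR.
have eZ c (X : R) : bcounit (c *: X) = c *: bcounit X by rewrite -!rdual_ev_one evZ.
split.
- exact: rdual_mul_bilinear.
- exact: rdual_mulA.
- split=> al; apply: rdual_bialgebroid_eq => X; rewrite (rdual_evM hR).
    rewrite -[in RHS](rb_counitl hR X) rdual_tsum.
    by apply: eq_tsum => X1 X2; rewrite rdual_ev_one.
  rewrite -[in RHS](rb_counitr hR X) rdual_tsum.
  by apply: eq_tsum => X1 X2; rewrite rdual_ev_one (rb_counit_tgtr hR) rdual_srcr.
- split=> [c a b||a b]; apply: rdual_bialgebroid_eq => X.
  + rewrite rdualDE rdualZE !rdual_ev_src; case: (rb_tgt hR) => -> _ _.
    by rewrite mulDl (rb_counitD hR) (bilZl (rb_mul_bilinear hR)) eZ.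
  + by rewrite rdual_ev_src (rb_tgt1 hR) m1l rdual_ev_one.
  by rewrite evs !rdual_ev_src (rb_tgtM hR) mulA.
- split=> [c a b||a b]; apply: rdual_bialgebroid_eq => X.
  + rewrite rdualDE rdualZE !rdual_ev_tgt; case: (rb_tgt hR) => -> _ _.
    by rewrite mulDr (rb_counitD hR) (bilZr (rb_mul_bilinear hR)) eZ.
  + by rewrite rdual_ev_tgt (rb_tgt1 hR) m1r rdual_ev_one.
  by rewrite evs !rdual_ev_tgt (rb_tgtM hR) mulA.
- move=> a b; apply: rdual_bialgebroid_eq => X.
  by rewrite (rdual_ev_srcl hR) (rdual_ev_tgtl hR) rdual_ev_src rdual_ev_tgt mulA.
- split=> [|c b al]; first exact: rdual_comulD.
  apply: (rdual_tensor2_eq hR (rdual_ev_blact hR) fR) => X Y.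
  rewrite rdual_ev_comul (tsum_tsum _ _ _ (pair_balanced X Y)) !evs mulA.
  under eq_tsum do rewrite !evs.
  rewrite -(morph_tsum (h := *%R c)) ?rdual_ev_comul //; exact: mulrDr.
- split=> [//|c b al] /=.
  by rewrite !evs m1r -[bsrc b]m1l rdual_srcr mulrA.
- exact: rdual_coassoc.
- move=> al; split; apply: rdual_bialgebroid_eq => X;
    rewrite (morph_tsum (h := fun be : D => ev be X)) //.
    rewrite -[X in RHS]m1r -rdual_ev_comul; apply: eq_tsum => al1 al2.
    by rewrite evs m1r -rdual_srcr m1l.
  rewrite -[X in RHS]m1l -rdual_ev_comul; apply: eq_tsum => al1 al2.
  by rewrite evs.
- move=> a al; apply: (rdual_tensor2_eq hR (rdual_ev_blact hR) fR) => X Y.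
  rewrite !(tsum_tsum _ _ _ (pair_balanced X Y)).
  under eq_tsum do rewrite evs mulA -(rb_src_tgt hR) -mulA.
  under [RHS]eq_tsum do rewrite evs.
  by rewrite !rdual_ev_comul mulA.
- exact: rdual_comul_mul.
- apply: (rdual_tensor2_eq hR (rdual_ev_blact hR) fR) => X Y.
  rewrite rdual_ev_comul (tsum_tens (pair_balanced X Y)) !rdual_ev_one.
  by case: (rb_counit_mul hR X Y).
- by rewrite -(rb_counit_one hR); apply: rdual_ev_one.
have e (al be : D) : bcounit (al ** be) = ev be (btgt (ev al bone)).
  rewrite [LHS](rdual_evM hR) (rb_comul_one hR).
  by rewrite (tsum_tens (mul_balanced al be)) m1l.
move=> al be; rewrite [RHS]e; split.
  by rewrite [LHS](rdual_ev_srcl hR) m1r.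
by rewrite [LHS](rdual_ev_tgtl hR) m1l.
Qed.

End RightDualBialgebroid.

(** * The right dual of a right-right Yetter-Drinfeld module *)

Section RightComoduleTools.
Variables (k : fieldType) (A : algType k) (R : bialgebroid_data A).
Variable G : rr_data R.
Hypotheses (hR : right_bialgebroid R) (hG : yd_right_right G).

Lemma rr_ract_bilinear : bilinear_map (@rr_ract k A R G).
Proof. by case: (rc_bimod (rr_comod hG)) => [[]]. Qed.

Lemma rr_ract1 (x : G) : rr_ract x 1 = x.
Proof. by case: (rc_bimod (rr_comod hG)) => _ /(_ x)[]. Qed.

Lemma rr_coact_lact a (x : G) :
  rr_coact (rr_lact a x) = \tsum_(x0, x1 <- rr_coact x) tens x0 (bsrc a ** x1).
Proof.
have := rc_bilinear (rr_comod hG) a x 1; rewrite rr_ract1 => ->.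
by apply: eq_tsum => x0 x1; rewrite (rb_src1 hR) (rb_mul1r hR).
Qed.

Lemma rc_coassoc_sum (H : zmodType) (K : G -> R -> R -> H) (x : G) :
  tribalanced (@rr_ract k A R G) (@blact k A R) (@bract k A R) (@blact k A R) K ->
  \tsum_(x0, x1 <- rr_coact x) \tsum_(y0, y1 <- rr_coact x0) K y0 y1 x1 =
  \tsum_(x0, x1 <- rr_coact x) \tsum_(X1, X2 <- bcomul x1) K x0 X1 X2.
Proof. by move=> KP; apply: coassoc_sum KP (rc_coassoc (rr_comod hG) x). Qed.

Lemma rc_counit_balanced : balanced (@rr_ract k A R G) (@blact k A R)
  (fun x0 x1 => rr_ract x0 (bcounit x1)).
Proof.
have rB := rr_ract_bilinear; split=> [y y' z|y z z'|y a z].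
- by rewrite (bilDl rB).
- by rewrite (rb_counitD hR) (bilDr rB).
by rewrite (rb_counit_tgtr hR); case: (rc_bimod (rr_comod hG)) => _ _ _ ->.
Qed.

End RightComoduleTools.

Section RightDualYD.
Variables (k : fieldType) (A : algType k) (R : bialgebroid_data A).
Variable G : rr_data R.
Hypotheses (hR : right_bialgebroid R) (hG : yd_right_right G).
Hypothesis fR : right_fgp (@bract k A R).
Hypothesis fG : right_fgp (@rr_ract k A R G).

Let mulA := rb_mulA hR.
Let mulDl := bilDl (rb_mul_bilinear hR).
Let mulDr := bilDr (rb_mul_bilinear hR).

Local Notation D := (rdual_bialgebroid R).
Local Notation E := (rdual_yd G).
Local Notation ev := (@rdual_fun k A R (@bract k A R)).
Local Notation evG := (@rdual_fun k A G (@rr_ract k A R G)).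

Let actM (x : G) (X Y : R) : rr_act x (X ** Y) = rr_act (rr_act x X) Y.
Proof. by case: (rr_mod hG). Qed.
Let act1 (x : G) : rr_act x bone = x.
Proof. by case: (rr_mod hG). Qed.
Let act_bilinear : bilinear_map (@rr_act k A R G).
Proof. by case: (rr_mod hG). Qed.

Let fD (f : E) x y : evG f (x + y) = evG f x + evG f y.
Proof. by case: (rdualP f) => ->. Qed.
Let fr (f : E) x a : evG f (rr_ract x a) = evG f x * a.
Proof. by case: (rdualP f) => _ ->. Qed.
Let fZ (f : E) c x : evG f (c *: x) = c *: evG f x.
Proof. exact: rdualZ (rr_ract_bilinear hG) (rr_ract1 hG) c x. Qed.
Let evZ (al : D) c X : ev al (c *: X) = c *: ev al X.
Proof. exact: rdualZ (bract_bilinear hR) (bract1 hR) c X. Qed.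

Let evs := (rdual_ev_srcl hR, rdual_ev_tgtl hR, rdual_ev_srcr hR,
  rdual_ev_tgtr hR, rdual_ev_bract hR, rdual_ev_blact hR).

Lemma rdual_yd_eq (f g : E) : evG f =1 evG g -> f = g.
Proof. exact: rdual_eq. Qed.

Lemma rdual_yd_lact a (f : E) x : evG (lr_lact a f) x = a * evG f x.
Proof. exact: rdual_lactE. Qed.

Lemma rdual_yd_ract (f : E) a x : evG (lr_ract f a) x = evG f (rr_act x (btgt a)).
Proof. exact: rdual_ractE. Qed.

Lemma rdual_yd_act (f : E) (al : D) x :
  evG (lr_act f al) x = \tsum_(x0, x1 <- rr_coact x) ev al (x1 ** btgt (evG f x0)).
Proof. exact: rdual_actE. Qed.

Lemma rdual_yd_coact (f : E) x X :
  \tsum_(f1, f0 <- lr_coact f) ev f1 (bsrc (evG f0 x) ** X) = evG f (rr_act x X).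
Proof. by have [-> _] := rdual_coactP hR hG f fG. Qed.

Let lE (a : A) (f : rdual (@rr_ract k A R G)) x :
  @lr_lact k A D E a f x = a * f x.
Proof. exact: rdual_yd_lact. Qed.

Let pair_balanced := rdual_pair_balanced hR lE.

(** The function that turns the Yetter-Drinfeld condition of [G] into that of
    the dual. *)
Lemma rdual_yd_act_balanced (f : E) (al : D) :
  balanced (@rr_ract k A R G) (@blact k A R)
    (fun x0 x1 => ev al (x1 ** btgt (evG f x0))).
Proof.
split=> [y y' z|y z z'|y a z].
- by rewrite fD (rb_tgtD hR) mulDr rdualD.
- by rewrite mulDl rdualD.
by rewrite fr (rb_tgtM hR) mulA.
Qed.

Lemma rdual_yd_bimodule : is_bimodule (@lr_lact k A D E) (@lr_ract k A D E).
Proof.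
split=> [|f|a b f|f a b|a f b].
- split; split=> [f|a] c x y; apply: rdual_yd_eq => z;
    rewrite rdualDE rdualZE ?rdual_yd_lact ?rdual_yd_ract.
  + by rewrite mulrDl scalerAl.
  + by rewrite rdualDE rdualZE mulrDr scalerAr.
  + by [].
  case: (rb_tgt hR) => -> _ _.
  by rewrite (bilDr act_bilinear) (bilZr act_bilinear) fD fZ.
- split; apply: rdual_yd_eq => x; first by rewrite rdual_yd_lact mul1r.
  by rewrite rdual_yd_ract (rb_tgt1 hR) act1.
- by apply: rdual_yd_eq => x; rewrite !rdual_yd_lact mulrA.
- by apply: rdual_yd_eq => x; rewrite !rdual_yd_ract (rb_tgtM hR) actM.
by apply: rdual_yd_eq => x; rewrite rdual_yd_lact !rdual_yd_ract rdual_yd_lact.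
Qed.

(** The values of the coaction describe the action of [R] on [G], so that its
    coassociativity is the associativity of that action, and the Takeuchi
    condition is the commutation of sources with targets. *)
Lemma rdual_yd_comodule : is_left_comodule E.
Proof.
split.
- exact: rdual_yd_bimodule.
- move=> f g; apply: (rdual_tensor2_eq hR lE fG) => x X.
  by rewrite (tsumD (pair_balanced x X)) !rdual_yd_coact rdualDE.
- move=> a f b; apply: (rdual_tensor2_eq hR lE fG) => x X.
  rewrite rdual_yd_coact (tsum_tsum _ _ _ (pair_balanced x X)).
  under eq_tsum do rewrite (rdual_ev_tgtr hR) (rdual_ev_tgtl hR) -mulA.
  rewrite -(morph_tsum (h := *%R a)); last exact: mulrDr.
  by rewrite rdual_yd_coact rdual_yd_lact rdual_yd_ract actM.
- move=> a f; apply: (rdual_tensor2_eq hR lE fG) => x X.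
  rewrite !(tsum_tsum _ _ _ (pair_balanced x X)).
  under eq_tsum do rewrite evs mulA -(rb_src_tgt hR) -mulA.
  under [RHS]eq_tsum do rewrite rdual_yd_ract.
  by rewrite !rdual_yd_coact actM.
- move=> f; apply: (rdual_tensor3_eq hR fR lE fG) => x X Y.
  have tri := rdual_triple_tribalanced hR lE x X Y.
  have bal := tribalanced_tsum tri.
  rewrite (tsum_tsum _ _ _ bal) (tsum_bind _ _ bal).
  under eq_tsum do rewrite (rdual_ev_comul hR fR) -mulA.
  rewrite rdual_yd_coact actM -rdual_yd_coact; apply: eq_tsum => f1 f0.
  rewrite (tsum_tsum _ _ _ bal) -(rdual_yd_coact f0).
  rewrite (morph_tsum _ _ (rdual_ev_src_additive hR f1 Y)); apply: eq_tsum => g1 g0.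
  by rewrite (tsum_tens (tri.1 g0)).
move=> f; apply: rdual_yd_eq => x.
rewrite (morph_tsum (h := fun g : E => evG g x)) // -[x in RHS]act1 -rdual_yd_coact.
apply: eq_tsum => f1 f0.
by rewrite rdual_yd_lact (rb_mul1r hR) -rdual_srcr (rb_mul1l hR).
Qed.

(** Unit and associativity of the action are counit and coassociativity of the
    coaction of [G]. *)
Lemma rdual_yd_module : is_right_module (@lr_act k A D E).
Proof.
split=> [|f|f al be].
- split=> [al|f] c f' f''; apply: rdual_yd_eq => x;
    rewrite rdualDE rdualZE !rdual_yd_act -tsum_linear; apply: eq_tsum => x0 x1.
    rewrite rdualDE rdualZE; case: (rb_tgt hR) => -> _ _.
    by rewrite mulDr (bilZr (rb_mul_bilinear hR)) rdualD evZ.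
  by rewrite rdualDE rdualZE.
- apply: rdual_yd_eq => x; rewrite rdual_yd_act -[in RHS](rc_counit (rr_comod hG) x).
  rewrite (morph_tsum _ _ (fD f)); apply: eq_tsum => x0 x1.
  by rewrite rdual_ev_one // (rb_counit_tgtr hR) fr.
apply: rdual_yd_eq => x; rewrite !rdual_yd_act.
have tri : tribalanced (@rr_ract k A R G) (@blact k A R) (@bract k A R) (@blact k A R)
  (fun x0 X1 X2 => ev be (X2 ** btgt (ev al (X1 ** btgt (evG f x0))))).
  split=> [Z|y]; last exact: rdual_mul_tgt_balanced.
  exact: balanced_comp (rdual_ev_tgt_additive hR be Z)
    (rdual_yd_act_balanced f al).
under [RHS]eq_tsum => x0 x1.
  rewrite rdual_yd_act (morph_tsum _ _ (rdual_ev_tgt_additive hR be x1)); over.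
rewrite (rc_coassoc_sum hG x tri); apply: eq_tsum => x0 x1.
rewrite (rdual_evM hR) (rb_comul_tgtr hR).
by rewrite (tsum_tsum _ _ _ (rdual_mul_balanced hR al be)).
Qed.

(** Evaluated at [x] and [Y], the left side of the compatibility condition loses
    the factors of [al] and becomes the image of the left side of the condition
    of [G], at [x] and [Y], under the function of [rdual_yd_act_balanced].  The
    right sides correspond likewise, after the Takeuchi condition has been used
    as in [rdual_comul_mul]. *)
Lemma rdual_yd_left_right : yd_left_right E.
Proof.
split.
- exact: rdual_yd_comodule.
- exact: rdual_yd_module.
- move=> f a; apply: rdual_yd_eq => x.
  rewrite rdual_yd_act rdual_yd_ract (rr_act_tgt hG).
  rewrite -[in RHS](rc_counit (rr_comod hG) (rr_lact a x)) (rr_coact_lact hR hG).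
  rewrite (tsum_tsum _ _ _ (rc_counit_balanced hR hG)) (morph_tsum _ _ (fD f)).
  apply: eq_tsum => x0 x1; rewrite rdual_ev_src // mulA (rb_counit_tgtr hR).
  by rewrite fr (rb_counit_srcl_tgtl hR).
- move=> f a; apply: rdual_yd_eq => x; rewrite rdual_yd_act rdual_yd_lact.
  rewrite -[in RHS](rc_counit (rr_comod hG) x) (morph_tsum _ _ (fD f)).
  rewrite (morph_tsum (h := *%R a)); last exact: mulrDr.
  apply: eq_tsum => x0 x1; rewrite rdual_ev_tgt // !(rb_counit_tgtr hR).
  by rewrite fr.
move=> f al; apply: (rdual_tensor2_eq hR lE fG) => x Y.
have bp := pair_balanced x Y; have ba := rdual_yd_act_balanced f al.
rewrite !(tsum_bind _ _ bp).
(* The value of [al2] acts on [rr_act x Y2] through a target, hence appears as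
   a source in the coaction, where [rdual_ev_comul] absorbs it. *)
transitivity (\tsum_(Y1, Y2 <- bcomul Y) \tsum_(z0, z1 <- rr_coact (rr_act x Y2))
    ev al (Y1 ** z1 ** btgt (evG f z0))).
  transitivity (\tsum_(al1, al2 <- bcomul al) \tsum_(Y1, Y2 <- bcomul Y)
      evG (lr_act f al1) (rr_lact (ev al2 Y1) (rr_act x Y2))).
    apply: eq_tsum => al1 al2; rewrite (tsum_tsum _ _ _ bp).
    under eq_tsum => f1 f0.
      rewrite (rdual_evM hR) (rb_comul_srcl hR).
      rewrite (tsum_tsum _ _ _ (rdual_mul_balanced hR al2 f1)).
      under eq_tsum do rewrite -mulA.
      over.
    rewrite exchange_tsum; apply: eq_tsum => Y1 Y2.
    by rewrite rdual_yd_coact actM (rr_act_tgt hG).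
  rewrite exchange_tsum; apply: eq_tsum => Y1 Y2.
  under eq_tsum => al1 al2.
    rewrite rdual_yd_act (rr_coact_lact hR hG).
    rewrite (tsum_tsum _ _ _ (rdual_yd_act_balanced f al1)).
    over.
  rewrite exchange_tsum; apply: eq_tsum => z0 z1.
  under eq_tsum do rewrite -mulA.
  by rewrite (rdual_ev_comul hR fR) mulA.
have := congr1 (fun u => tsum u (fun z0 z1 => ev al (z1 ** btgt (evG f z0))))
  (rr_yd hG x Y).
rewrite /= !(tsum_bind _ _ ba).
under eq_tsum do rewrite (tsum_tsum _ _ _ ba).
move=> ->.
under eq_tsum do rewrite (tsum_tsum _ _ _ ba).
under [RHS]eq_tsum => f1 f0.
  rewrite (tsum_tsum _ _ _ bp).
  under eq_tsum => al1 al2.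
    rewrite (rdual_evM hR) (rb_comul_srcl hR).
    rewrite (tsum_tsum _ _ _ (rdual_mul_balanced hR f1 al1)) rdual_yd_act.
    under eq_tsum => Y1 Y2.
      rewrite -mulA (morph_tsum _ _ (rdual_ev_src_additive hR al1 _)).
      over.
    rewrite exchange_tsum.
    over.
  rewrite exchange_tsum.
  over.
rewrite [RHS]exchange_tsum; apply: eq_tsum => x0 x1.
under [RHS]eq_tsum => f1 f0.
  rewrite exchange_tsum.
  under eq_tsum do rewrite (rdual_ev_comul hR fR) -mulA (mulA (btgt _)) mulA.
  rewrite -(rb_takeuchi_sum hR _ _ (rdual_mul_mull_balanced hR f1 al x1)).
  over.
rewrite [RHS]exchange_tsum; apply: eq_tsum => Y1 Y2.
by rewrite -rdual_yd_coact (morph_tsum _ _ (rdual_ev_tgt_additive hR al _)).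
Qed.

End RightDualYD.

(** * Right-left biduality *)

Section RightBidual.
Variables (k : fieldType) (A : algType k) (R : bialgebroid_data A).
Hypothesis hR : right_bialgebroid R.
Hypothesis fR : right_fgp (@bract k A R).

Local Notation D := (rdual_bialgebroid R).
Local Notation ev := (@rdual_fun k A R (@bract k A R)).
Local Notation h := (@bialgebroid_ev_rl k A R).

Let hD := rdual_right_bialgebroid hR fR.
Let fD : left_fgp (@blact k A D) := rdual_left_fgp fR (rdual_ev_blact hR).

Let hE X (al : D) : h X al = ev al X.
Proof. exact: bialgebroid_ev_rlE. Qed.

(** Products agree because the formula that characterises the coproduct of the
    right dual is the one that defines the product of the left dual.
    Coproducts agree because the image of [bcomul X] has the values that
    characterise the coproduct of the image of [X]. *)
Lemma bialgebroid_ev_rl_iso : bialgebroid_iso h.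
Proof.
split.
- exact: rdual_bidual_bij fR (rdual_ev_blact hR) hE.
- move=> c X Y; apply: ldual_eq => al.
  rewrite ldualDE ldualZE !hE rdualD.
  by rewrite (rdualZ _ (bract_bilinear hR) (bract1 hR)).
- move=> X Y; apply: ldual_eq => al; rewrite hE [RHS](ldual_mulE hD).
  rewrite -(rdual_ev_comul hR fR); apply: eq_tsum => al1 al2.
  by rewrite !hE (rdual_ev_srcr hR).
- by apply: ldual_eq => al; rewrite [LHS]hE [RHS](ldual_oneE hD).
- move=> a; apply: ldual_eq => al; rewrite hE [RHS](ldual_srcE hD).
  by rewrite [RHS](rdual_ev_srcr hR) (rb_mul1r hR).
- move=> a; apply: ldual_eq => al; rewrite hE [RHS](ldual_tgtE hD).
  by rewrite [RHS](rdual_ev_srcl hR) (rb_mul1r hR).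
- move=> X; apply: (ldual_comulP hD (h X) fD).2 => al be.
  rewrite (tsum_tsum _ _ _ (ldual_comul_balanced hD al be)) hE (rdual_evM hR).
  apply: eq_tsum => X1 X2.
  by rewrite (ldual_mul_tgtr hD) !hE (rdual_ev_tgtl hR).
by move=> X; rewrite [LHS]hE; apply: rdual_ev_one.
Qed.

Section Module.
Variable G : rr_data R.
Hypothesis hG : yd_right_right G.
Hypothesis fG : right_fgp (@rr_ract k A R G).

Local Notation E := (rdual_yd G).
Local Notation evG := (@rdual_fun k A G (@rr_ract k A R G)).

Let hYD := rdual_yd_left_right hR hG fR fG.

Definition yd_ev_rl (x : G) : ldual_yd E := ldual_of _ (fun f : E => evG f x).

Let gE x (f : E) : yd_ev_rl x f = evG f x.
Proof. by rewrite ldual_ofE //; split=> // a g; apply: rdual_yd_lact. Qed.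

Let fE : left_fgp (@lr_lact k A D E).
Proof. exact: rdual_left_fgp fG (@rdual_yd_lact k A R G). Qed.

(** The formula that characterises the coaction of the right dual is the one
    that defines the action on the left dual, and the image of [rr_coact x] has
    the values that characterise the coaction of the image of [x]. *)
Lemma yd_ev_rl_iso : rr_iso h yd_ev_rl.
Proof.
have rB := rr_ract_bilinear hG; split.
- exact: rdual_bidual_bij fG (@rdual_yd_lact k A R G) gE.
- move=> c x y; apply: ldual_eq => f.
  rewrite ldualDE ldualZE !gE; case: (rdualP f) => -> _.
  by rewrite (rdualZ _ rB (rr_ract1 hG)).
- move=> a x; apply: ldual_eq => f; rewrite gE [RHS](ldual_lactE hYD) gE.
  by rewrite (rdual_yd_ract hR hG) (rr_act_tgt hG).
- move=> x a; apply: ldual_eq => f; rewrite gE [RHS](ldual_ractE) gE.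
  by case: (rdualP f) => _ ->.
- move=> x X; apply: ldual_eq => f; rewrite gE [RHS](ldual_actE hD hYD).
  rewrite -(rdual_yd_coact hR hG fG); apply: eq_tsum => f1 f0.
  by rewrite [RHS](ldual_mul_srcl hD) hE gE (rdual_ev_srcr hR).
move=> x; apply: (ldual_coactP hD hYD (yd_ev_rl x) fE).2 => f al.
rewrite (tsum_tsum _ _ _ (ldual_coact_balanced hD f al)) gE.
rewrite (rdual_yd_act hR hG); apply: eq_tsum => x0 x1.
by rewrite [RHS](ldual_mul_tgtr hD) hE gE (rdual_ev_tgtl hR).
Qed.

End Module.
End RightBidual.

(** * Evaluation of tensors of left duals *)

Section LeftDualSeparation.
Variables (k : fieldType) (A : algType k) (R : bialgebroid_data A).
Hypothesis hR : right_bialgebroid R.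

Let mulA := rb_mulA hR.
Let mulDl := bilDl (rb_mul_bilinear hR).
Let mulDr := bilDr (rb_mul_bilinear hR).

Local Notation D := (ldual_bialgebroid R).
Local Notation ev := (@ldual_fun k A R (@blact k A R)).

Lemma ldual_bialgebroid_eq (X Y : D) : ev X =1 ev Y -> X = Y.
Proof. exact: ldual_eq. Qed.

Lemma ldual_evM (X Y : D) al :
  ev (X ** Y) al = \tsum_(al1, al2 <- bcomul al) ev Y (al1 ** bsrc (ev X al2)).
Proof. exact: ldual_mulE. Qed.

Lemma ldual_ev_srcl c (X : D) al : ev (bsrc c ** X) al = ev X (al ** bsrc c).
Proof. exact: ldual_mul_srcl. Qed.

Lemma ldual_ev_tgtl a (X : D) al : ev (btgt a ** X) al = ev X (bsrc a ** al).
Proof. exact: ldual_mul_tgtl. Qed.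

Lemma ldual_ev_srcr f (X : D) al : ev (X ** bsrc f) al = ev X al * f.
Proof. exact: ldual_mul_srcr. Qed.

Lemma ldual_ev_tgtr b (X : D) al : ev (X ** btgt b) al = ev X (btgt b ** al).
Proof. exact: ldual_mul_tgtr. Qed.

Lemma ldual_ev_bract (X : D) f al : ev (bract X f) al = ev X al * f.
Proof. exact: ldual_ev_srcr. Qed.

Lemma ldual_ev_blact b (X : D) al : ev (blact b X) al = ev X (btgt b ** al).
Proof. exact: ldual_ev_tgtr. Qed.

Lemma ldual_ev_src_additive (X : D) al :
  {morph (fun a => ev X (al ** bsrc a)) : a b / a + b}.
Proof. by move=> a b; rewrite (rb_srcD hR) mulDr ldualD. Qed.

Lemma ldual_ev_tgt_additive (X : D) al :
  {morph (fun a => ev X (btgt a ** al)) : a b / a + b}.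
Proof. by move=> a b; rewrite (rb_tgtD hR) mulDl ldualD. Qed.

Lemma ldual_mul_mull_balanced (X Y : D) al :
  balanced (@bract k A R) (@blact k A R)
    (fun be1 be2 => ev Y (al ** be1 ** bsrc (ev X be2))).
Proof.
split=> [be1 be1' be2|be1 be2 be2'|be1 a be2].
- by rewrite mulDr mulDl ldualD.
- by rewrite ldualD (rb_srcD hR) mulDr ldualD.
by rewrite ldual_tgtr (rb_srcM hR) !mulA.
Qed.

Lemma ldual_mul_src_balanced (X Y : D) c :
  balanced (@bract k A R) (@blact k A R)
    (fun al1 al2 => ev Y (al1 ** bsrc (ev X (al2 ** bsrc c)))).
Proof.
split=> [al1 al1' al2|al1 al2 al2'|al1 a al2].
- by rewrite mulDl ldualD.
- by rewrite mulDl ldualD ldual_ev_src_additive.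
rewrite /bract /blact -(mulA al2) -(rb_src_tgt hR) mulA ldual_tgtr.
by rewrite (rb_srcM hR) mulA.
Qed.

Section WithModule.
Variables (V : lmodType k) (l : A -> V -> V) (r : ldual l -> A -> ldual l).
Hypothesis rE : forall f a x, r f a x = f x * a.

Lemma ldual_pair_balanced x be :
  balanced r (@blact k A D) (fun f X => ev X (btgt (f x) ** be)).
Proof.
split=> [f f' X|f X X'|f c X]; last 2 first.
- by [].
- by rewrite ldual_ev_blact rE (rb_tgtM hR) mulA.
by rewrite ldualDE (rb_tgtD hR) mulDl ldualD.
Qed.

Lemma ldual_triple_tribalanced x be ga :
  tribalanced r (@blact k A D) (@bract k A D) (@blact k A D)
   (fun f X Y => ev Y (btgt (ev X (btgt (f x) ** be)) ** ga)).
Proof.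
split=> [Y|f].
  exact: balanced_comp (ldual_ev_tgt_additive Y ga) (ldual_pair_balanced x be).
split=> [X X' Y|X Y Y'|X c Y]; last 2 first.
- by [].
- by rewrite ldual_ev_bract ldual_ev_blact (rb_tgtM hR) mulA.
by rewrite ldualDE (rb_tgtD hR) mulDl ldualD.
Qed.

Hypothesis fl : left_fgp l.

Lemma ldual_tensor2_eq (u v : tensor r (@blact k A D)) :
  (forall x be, \tsum_(f, X <- u) ev X (btgt (f x) ** be) =
                \tsum_(f, X <- v) ev X (btgt (f x) ** be)) -> u = v.
Proof.
move=> uv; apply: (ldual_tensor_sep fl rE) => x.
apply: ldual_bialgebroid_eq => be.
rewrite !(morph_tsum (h := fun X : D => ev X be)) //.
under eq_tsum do rewrite ldual_ev_blact.
by under [RHS]eq_tsum do rewrite ldual_ev_blact.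
Qed.

End WithModule.

Hypothesis fR : left_fgp (@blact k A R).

(** Contraction of the first factor at [x] leaves a tensor of the last two
    factors, to which [ldual_tensor2_eq] applies. *)
Lemma ldual_tensor3_eq (V : lmodType k) (l : A -> V -> V)
    (r : ldual l -> A -> ldual l)
    (u v : tensor (@tensor_ract A (ldual l) D r (@blact k A D) A (@bract k A D))
             (@blact k A D)) :
  (forall f a x, r f a x = f x * a) -> left_fgp l ->
  (forall x be ga,
     \tsum_(w, Y <- u) \tsum_(f, X <- w)
        ev Y (btgt (ev X (btgt (f x) ** be)) ** ga) =
     \tsum_(w, Y <- v) \tsum_(f, X <- w)
        ev Y (btgt (ev X (btgt (f x) ** be)) ** ga)) -> u = v.
Proof.
move=> rE fl uv; apply: (ldual_tensor3_sep _ _ fl rE) => [b X Y|a X b|x].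
- by apply: ldual_bialgebroid_eq => be; rewrite !ldualDE !ldual_ev_bract mulrDl.
- apply: ldual_bialgebroid_eq => be.
  by rewrite ldual_ev_blact !ldual_ev_bract ldual_ev_blact.
apply: (ldual_tensor2_eq ldual_ev_bract fR) => be ga.
have bal := ldual_pair_balanced ldual_ev_bract be ga.
rewrite !(tsum_tsum _ _ _ bal).
have e (w : tensor r (@blact k A D)) (Y : D) :
  ev Y (btgt (ev (\tsum_(f, X <- w) blact (f x) X) be) ** ga)
  = \tsum_(f, X <- w) ev Y (btgt (ev X (btgt (f x) ** be)) ** ga).
  rewrite (morph_tsum (h := fun X : D => ev X be)) //.
  rewrite (morph_tsum _ _ (ldual_ev_tgt_additive Y ga)).
  by apply: eq_tsum => f X; rewrite ldual_ev_blact.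
under eq_tsum do rewrite e.
by under [RHS]eq_tsum do rewrite e.
Qed.

End LeftDualSeparation.

(** * The left dual of a bialgebroid *)

Section LeftDualBialgebroid.
Variables (k : fieldType) (A : algType k) (R : bialgebroid_data A).
Hypothesis hR : right_bialgebroid R.
Hypothesis fR : left_fgp (@blact k A R).

Let mulA := rb_mulA hR.
Let mulDl := bilDl (rb_mul_bilinear hR).
Let mulDr := bilDr (rb_mul_bilinear hR).

Local Notation D := (ldual_bialgebroid R).
Local Notation ev := (@ldual_fun k A R (@blact k A R)).

Let evZ (X : D) c al : ev X (c *: al) = c *: ev X al.
Proof. exact: ldualZ (blact_bilinear hR) (blact1 hR) c al. Qed.

Let evs := (ldual_ev_srcl hR, ldual_ev_tgtl hR, ldual_ev_srcr hR,
  ldual_ev_tgtr hR, ldual_ev_bract hR, ldual_ev_blact hR).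

Let mul_balanced (X Y : D) := ldual_mul_balanced hR X Y.

Let pair_balanced := ldual_pair_balanced hR (ldual_ev_bract hR).

Lemma ldual_ev_one al : ev (bone : D) al = bcounit al.
Proof. exact: ldual_oneE. Qed.

Lemma ldual_ev_src c al : ev (bsrc c : D) al = bcounit (al ** bsrc c).
Proof. exact: ldual_srcE. Qed.

Lemma ldual_ev_tgt a al : ev (btgt a : D) al = bcounit (bsrc a ** al).
Proof. exact: ldual_tgtE. Qed.

Lemma ldual_ev_comul (X : D) al be :
  \tsum_(X1, X2 <- bcomul X) ev X2 (btgt (ev X1 al) ** be) = ev X (al ** be).
Proof.
have [-> _] := ldual_comulP hR X fR.
by apply: eq_tsum => X1 X2; rewrite (ldual_mul_tgtr hR).
Qed.

Lemma ldual_mul_bilinear : bilinear_map (@bmul k A D).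
Proof.
split=> [Y|X] c x y; apply: ldual_bialgebroid_eq => al.
  rewrite ldualDE ldualZE !(ldual_evM hR) -tsum_linear.
  apply: eq_tsum => al1 al2; rewrite ldualDE ldualZE.
  by case: (rb_src hR) => -> _ _; rewrite mulDr (bilZr (rb_mul_bilinear hR)) ldualD evZ.
rewrite ldualDE ldualZE !(ldual_evM hR) -tsum_linear.
by apply: eq_tsum => al1 al2; rewrite ldualDE ldualZE.
Qed.

(** As for [rdual_mulA], the innermost value being now taken at the last of the
    three Sweedler factors. *)
Lemma ldual_mulA : associative (@bmul k A D).
Proof.
move=> X Y Z; apply: ldual_bialgebroid_eq => al.
have tri : tribalanced (@bract k A R) (@blact k A R) (@bract k A R) (@blact k A R)
  (fun al1 al2 al3 => ev Z (al1 ** bsrc (ev Y (al2 ** bsrc (ev X al3))))).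
  split=> [be|be]; first exact: ldual_mul_src_balanced.
  exact: balanced_comp (ldual_ev_src_additive hR Z be) (mul_balanced X Y).
rewrite !(ldual_evM hR).
under [RHS]eq_tsum => al1 al2.
  rewrite (ldual_evM hR) (morph_tsum _ _ (ldual_ev_src_additive hR Z al1)); over.
rewrite -(rb_coassoc_sum hR al tri); apply: eq_tsum => al1 al2.
by rewrite (ldual_evM hR) (rb_comul_srcr hR) (tsum_tsum _ _ _ (mul_balanced Y Z)).
Qed.

Lemma ldual_comulD : {morph @bcomul k A D : X Y / X + Y}.
Proof.
move=> X Y; apply: (ldual_tensor2_eq hR (ldual_ev_bract hR) fR) => al be.
by rewrite (tsumD (pair_balanced al be)) !ldual_ev_comul ldualDE.
Qed.

Lemma ldual_coassoc (X : D) :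
  \tsum_(X1, X2 <- bcomul X) tens (bcomul X1) X2 =
  \tsum_(X1, X2 <- bcomul X) \tsum_(Y1, Y2 <- bcomul X2)
     tens (tens X1 Y1) Y2
  :> tensor (tensor_ract (@bract k A D)) (@blact k A D).
Proof.
have rE := ldual_ev_bract hR.
apply: (ldual_tensor3_eq hR fR rE fR) => al be ga.
have tri := ldual_triple_tribalanced hR rE al be ga.
have bal := tribalanced_tsum tri.
rewrite (tsum_tsum _ _ _ bal) (tsum_bind _ _ bal).
under eq_tsum => X1 X2.
  rewrite -(morph_tsum _ _ (ldual_ev_tgt_additive hR X2 ga)) ldual_ev_comul; over.
rewrite ldual_ev_comul -mulA -(ldual_ev_comul X); apply: eq_tsum => X1 X2.
rewrite (tsum_tsum _ _ _ bal) mulA -(ldual_ev_comul X2).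
apply: eq_tsum => Y1 Y2.
by rewrite (tsum_tens (tri.1 Y2)).
Qed.

(** Mirror image of [rdual_comul_mul]: the value of [X1] at [al2] is a source in
    front of [be1], and the Takeuchi condition makes it a target in front of
    [be2], where the factors of [X] recombine into the value at [al2 ** be2]. *)
Lemma ldual_comul_mul (X Y : D) : bcomul (X ** Y) =
  \tsum_(X1, X2 <- bcomul X) \tsum_(Y1, Y2 <- bcomul Y)
     tens (X1 ** Y1) (X2 ** Y2).
Proof.
apply: (ldual_tensor2_eq hR (ldual_ev_bract hR) fR) => al be.
rewrite (tsum_bind _ _ (pair_balanced al be)) ldual_ev_comul (ldual_evM hR).
have bm := mul_balanced X Y.
rewrite (rb_comul_mul hR) (tsum_bind _ _ bm).
transitivity (\tsum_(al1, al2 <- bcomul al) \tsum_(be1, be2 <- bcomul be)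
  \tsum_(X1, X2 <- bcomul X)
    ev Y (al1 ** bsrc (ev X1 al2) ** (be1 ** bsrc (ev X2 be2)))).
  apply: eq_tsum => al1 al2; rewrite (tsum_tsum _ _ _ bm).
  transitivity (\tsum_(be1, be2 <- bcomul be) \tsum_(X1, X2 <- bcomul X)
      ev Y (al1 ** be1 ** bsrc (ev X2 (btgt (ev X1 al2) ** be2)))).
    apply: eq_tsum => be1 be2; rewrite -(ldual_ev_comul X).
    exact: (morph_tsum _ _ (ldual_ev_src_additive hR Y _)).
  rewrite exchange_tsum [RHS]exchange_tsum; apply: eq_tsum => X1 X2.
  rewrite -(rb_takeuchi_sum hR _ _ (ldual_mul_mull_balanced hR X2 Y al1)).
  by apply: eq_tsum => be1 be2; rewrite !mulA.
under eq_tsum => al1 al2 do rewrite exchange_tsum.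
rewrite exchange_tsum; apply: eq_tsum => X1 X2.
rewrite (tsum_tsum _ _ _ (pair_balanced al be)).
under [RHS]eq_tsum => Y1 Y2.
  rewrite !(ldual_evM hR) (rb_comul_tgtl hR) (tsum_tsum _ _ _ (mul_balanced X2 Y2)).
  under eq_tsum => be1 be2.
    rewrite -mulA (morph_tsum _ _ (ldual_ev_tgt_additive hR Y2 _)); over.
  over.
rewrite exchange_tsum [RHS]exchange_tsum; apply: eq_tsum => be1 be2.
rewrite [RHS]exchange_tsum; apply: eq_tsum => al1 al2.
by rewrite -ldual_ev_comul.
Qed.

Lemma ldual_right_bialgebroid : right_bialgebroid D.
Proof.
have m1l := rb_mul1l hR; have m1r := rb_mul1r hR.
have eZ c (al : R) : bcounit (c *: al) = c *: bcounit al by rewrite -!ldual_ev_one evZ.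
split.
- exact: ldual_mul_bilinear.
- exact: ldual_mulA.
- split=> X; apply: ldual_bialgebroid_eq => al; rewrite (ldual_evM hR).
    rewrite -[in RHS](rb_counitr hR al) ldual_tsum.
    by apply: eq_tsum => al1 al2; rewrite ldual_ev_one.
  rewrite -[in RHS](rb_counitl hR al) ldual_tsum.
  by apply: eq_tsum => al1 al2; rewrite ldual_ev_one (rb_counit_srcr hR) ldual_tgtr.
- split=> [c a b||a b]; apply: ldual_bialgebroid_eq => al.
  + rewrite ldualDE ldualZE !ldual_ev_src; case: (rb_src hR) => -> _ _.
    by rewrite mulDr (rb_counitD hR) (bilZr (rb_mul_bilinear hR)) eZ.
  + by rewrite ldual_ev_src (rb_src1 hR) m1r ldual_ev_one.
  by rewrite (ldual_ev_srcl hR) !ldual_ev_src (rb_srcM hR) mulA.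
- split=> [c a b||a b]; apply: ldual_bialgebroid_eq => al.
  + rewrite ldualDE ldualZE !ldual_ev_tgt; case: (rb_src hR) => -> _ _.
    by rewrite mulDl (rb_counitD hR) (bilZl (rb_mul_bilinear hR)) eZ.
  + by rewrite ldual_ev_tgt (rb_src1 hR) m1l ldual_ev_one.
  by rewrite (ldual_ev_tgtl hR) !ldual_ev_tgt (rb_srcM hR) mulA.
- move=> a b; apply: ldual_bialgebroid_eq => al.
  by rewrite (ldual_ev_srcl hR) (ldual_ev_tgtl hR) ldual_ev_src ldual_ev_tgt mulA.
- split=> [|c b X]; first exact: ldual_comulD.
  apply: (ldual_tensor2_eq hR (ldual_ev_bract hR) fR) => al be.
  rewrite ldual_ev_comul (tsum_tsum _ _ _ (pair_balanced al be)) !evs mulA.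
  under eq_tsum do rewrite !evs.
  rewrite -(morph_tsum (h := *%R^~ b)) ?ldual_ev_comul //.
  by move=> x y; apply: mulrDl.
- split=> [//|c b X] /=.
  by rewrite !evs m1r -[btgt c]m1l ldual_tgtr.
- exact: ldual_coassoc.
- move=> X; split; apply: ldual_bialgebroid_eq => al;
    rewrite (morph_tsum (h := fun Y : D => ev Y al)) //.
    rewrite -[al in RHS]m1l -ldual_ev_comul; apply: eq_tsum => X1 X2.
    by rewrite evs.
  rewrite -[al in RHS]m1r -ldual_ev_comul; apply: eq_tsum => X1 X2.
  by rewrite evs m1r -ldual_tgtr m1l.
- move=> a X; apply: (ldual_tensor2_eq hR (ldual_ev_bract hR) fR) => al be.
  rewrite !(tsum_tsum _ _ _ (pair_balanced al be)).
  under eq_tsum do rewrite evs.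
  under [RHS]eq_tsum do rewrite evs mulA (rb_src_tgt hR) -mulA.
  by rewrite !ldual_ev_comul mulA.
- exact: ldual_comul_mul.
- apply: (ldual_tensor2_eq hR (ldual_ev_bract hR) fR) => al be.
  rewrite ldual_ev_comul (tsum_tens (pair_balanced al be)) !ldual_ev_one.
  by case: (rb_counit_mul hR al be).
- by rewrite -(rb_counit_one hR); apply: ldual_ev_one.
have e (X Y : D) : bcounit (X ** Y) = ev Y (bsrc (ev X bone)).
  rewrite [LHS](ldual_evM hR) (rb_comul_one hR).
  by rewrite (tsum_tens (mul_balanced X Y)) m1l.
move=> X Y; rewrite [RHS]e; split.
  by rewrite [LHS](ldual_ev_srcl hR) m1l.
by rewrite [LHS](ldual_ev_tgtl hR) m1r.
Qed.

End LeftDualBialgebroid.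

(** * The left dual of a left-right Yetter-Drinfeld module *)

Section LeftComoduleTools.
Variables (k : fieldType) (A : algType k) (R : bialgebroid_data A).
Variable T : lr_data R.
Hypotheses (hR : right_bialgebroid R) (hT : yd_left_right T).

Lemma lr_lact_bilinear : bilinear_map (@lr_lact k A R T).
Proof. by case: (lc_bimod (lr_comod hT)) => [[]]. Qed.

Lemma lr_lact1 (f : T) : lr_lact 1 f = f.
Proof. by case: (lc_bimod (lr_comod hT)) => _ /(_ f)[]. Qed.

Lemma lr_coact_ract (f : T) b :
  lr_coact (lr_ract f b) = \tsum_(f1, f0 <- lr_coact f) tens (btgt b ** f1) f0.
Proof.
have := lc_bilinear (lr_comod hT) 1 f b; rewrite lr_lact1 => ->.
by apply: eq_tsum => f1 f0; rewrite (rb_tgt1 hR) (rb_mul1r hR).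
Qed.

Lemma lc_coassoc_sum (H : zmodType) (K : R -> R -> T -> H) (f : T) :
  tribalanced (@bract k A R) (@blact k A R) (@bract k A R) (@lr_lact k A R T) K ->
  \tsum_(f1, f0 <- lr_coact f) \tsum_(al1, al2 <- bcomul f1) K al1 al2 f0 =
  \tsum_(f1, f0 <- lr_coact f) \tsum_(g1, g0 <- lr_coact f0) K f1 g1 g0.
Proof. by move=> KP; apply: coassoc_sum KP (lc_coassoc (lr_comod hT) f). Qed.

Lemma lc_counit_balanced : balanced (@bract k A R) (@lr_lact k A R T)
  (fun f1 f0 => lr_lact (bcounit f1) f0).
Proof.
have lB := lr_lact_bilinear; split=> [y y' z|y z z'|y a z].
- by rewrite (rb_counitD hR) (bilDl lB).
- by rewrite (bilDr lB).
by rewrite (rb_counit_srcr hR); case: (lc_bimod (lr_comod hT)) => _ _ ->.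
Qed.

End LeftComoduleTools.

Section LeftDualYD.
Variables (k : fieldType) (A : algType k) (R : bialgebroid_data A).
Variable T : lr_data R.
Hypotheses (hR : right_bialgebroid R) (hT : yd_left_right T).
Hypothesis fR : left_fgp (@blact k A R).
Hypothesis fT : left_fgp (@lr_lact k A R T).

Let mulA := rb_mulA hR.
Let mulDl := bilDl (rb_mul_bilinear hR).
Let mulDr := bilDr (rb_mul_bilinear hR).

Local Notation D := (ldual_bialgebroid R).
Local Notation E := (ldual_yd T).
Local Notation ev := (@ldual_fun k A R (@blact k A R)).
Local Notation evT := (@ldual_fun k A T (@lr_lact k A R T)).

Let actM (f : T) (al be : R) : lr_act f (al ** be) = lr_act (lr_act f al) be.
Proof. by case: (lr_mod hT). Qed.
Let act1 (f : T) : lr_act f bone = f.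
Proof. by case: (lr_mod hT). Qed.
Let act_bilinear : bilinear_map (@lr_act k A R T).
Proof. by case: (lr_mod hT). Qed.

Let xD (x : E) f g : evT x (f + g) = evT x f + evT x g.
Proof. by case: (ldualP x) => ->. Qed.
Let xl (x : E) a f : evT x (lr_lact a f) = a * evT x f.
Proof. by case: (ldualP x) => _ ->. Qed.
Let xZ (x : E) c f : evT x (c *: f) = c *: evT x f.
Proof. exact: ldualZ (lr_lact_bilinear hT) (lr_lact1 hT) c f. Qed.
Let evZ (X : D) c al : ev X (c *: al) = c *: ev X al.
Proof. exact: ldualZ (blact_bilinear hR) (blact1 hR) c al. Qed.

Let evs := (ldual_ev_srcl hR, ldual_ev_tgtl hR, ldual_ev_srcr hR,
  ldual_ev_tgtr hR, ldual_ev_bract hR, ldual_ev_blact hR).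

Lemma ldual_yd_eq (x y : E) : evT x =1 evT y -> x = y.
Proof. exact: ldual_eq. Qed.

Lemma ldual_yd_lact a (x : E) f : evT (rr_lact a x) f = evT x (lr_act f (bsrc a)).
Proof. by rewrite (lr_act_src hT); apply: ldual_lactE. Qed.

Lemma ldual_yd_ract (x : E) b f : evT (rr_ract x b) f = evT x f * b.
Proof. exact: ldual_ractE. Qed.

Lemma ldual_yd_act (x : E) (X : D) f :
  evT (rr_act x X) f = \tsum_(f1, f0 <- lr_coact f) ev X (f1 ** bsrc (evT x f0)).
Proof.
rewrite [LHS](ldual_actE hR hT); apply: eq_tsum => f1 f0.
exact: ldual_mul_srcl.
Qed.

Lemma ldual_yd_coact (x : E) f al :
  \tsum_(x0, x1 <- rr_coact x) ev x1 (btgt (evT x0 f) ** al) = evT x (lr_act f al).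
Proof.
have [-> _] := ldual_coactP hR hT x fT.
by apply: eq_tsum => x0 x1; rewrite [RHS](ldual_mul_tgtr hR).
Qed.

Let rE (x : ldual (@lr_lact k A R T)) (a : A) f :
  @rr_ract k A D E x a f = x f * a.
Proof. exact: ldual_yd_ract. Qed.

Let pair_balanced := ldual_pair_balanced hR rE.

Lemma ldual_yd_act_balanced (x : E) (X : D) :
  balanced (@bract k A R) (@lr_lact k A R T)
    (fun f1 f0 => ev X (f1 ** bsrc (evT x f0))).
Proof.
split=> [y y' z|y z z'|y a z].
- by rewrite mulDl ldualD.
- by rewrite xD (rb_srcD hR) mulDr ldualD.
by rewrite xl (rb_srcM hR) mulA.
Qed.

Lemma ldual_yd_bimodule : is_bimodule (@rr_lact k A D E) (@rr_ract k A D E).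
Proof.
split=> [|x|a b x|x a b|a x b].
- split; split=> [x|a] c y z; apply: ldual_yd_eq => f;
    rewrite ldualDE ldualZE ?ldual_yd_lact ?ldual_yd_ract.
  + case: (rb_src hR) => -> _ _.
    by rewrite (bilDr act_bilinear) (bilZr act_bilinear) xD xZ.
  + by [].
  + by rewrite ldualDE ldualZE mulrDl scalerAl.
  by rewrite mulrDr scalerAr.
- split; apply: ldual_yd_eq => f; last by rewrite ldual_yd_ract mulr1.
  by rewrite ldual_yd_lact (rb_src1 hR) act1.
- by apply: ldual_yd_eq => f; rewrite !ldual_yd_lact (rb_srcM hR) actM.
- by apply: ldual_yd_eq => f; rewrite !ldual_yd_ract mulrA.
by apply: ldual_yd_eq => f; rewrite ldual_yd_lact !ldual_yd_ract ldual_yd_lact.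
Qed.

Lemma ldual_yd_comodule : is_right_comodule E.
Proof.
split.
- exact: ldual_yd_bimodule.
- move=> x y; apply: (ldual_tensor2_eq hR rE fT) => f al.
  by rewrite (tsumD (pair_balanced f al)) !ldual_yd_coact ldualDE.
- move=> a x b; apply: (ldual_tensor2_eq hR rE fT) => f al.
  rewrite ldual_yd_coact (tsum_tsum _ _ _ (pair_balanced f al)).
  under eq_tsum do rewrite (ldual_ev_srcr hR) (ldual_ev_srcl hR) -mulA.
  rewrite -(morph_tsum (h := *%R^~ b)); last by move=> y z; apply: mulrDl.
  by rewrite ldual_yd_coact ldual_yd_lact ldual_yd_ract actM.
- move=> a x; apply: (ldual_tensor2_eq hR rE fT) => f al.
  rewrite !(tsum_tsum _ _ _ (pair_balanced f al)).
  under eq_tsum do rewrite ldual_yd_lact.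
  under [RHS]eq_tsum do rewrite evs mulA (rb_src_tgt hR) -mulA.
  by rewrite !ldual_yd_coact actM.
- move=> x; apply: (ldual_tensor3_eq hR fR rE fT) => f al be.
  have tri := ldual_triple_tribalanced hR rE f al be.
  have bal := tribalanced_tsum tri.
  rewrite (tsum_tsum _ _ _ bal) (tsum_bind _ _ bal).
  under eq_tsum => x0 x1.
    rewrite -(morph_tsum _ _ (ldual_ev_tgt_additive hR x1 be)) ldual_yd_coact; over.
  rewrite ldual_yd_coact -actM -(ldual_yd_coact x); apply: eq_tsum => x0 x1.
  rewrite (tsum_tsum _ _ _ bal) mulA -(ldual_ev_comul hR fR x1).
  apply: eq_tsum => X1 X2.
  by rewrite (tsum_tens (tri.1 X2)).
move=> x; apply: ldual_yd_eq => f.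
rewrite (morph_tsum (h := fun y : E => evT y f)) // -[f in RHS]act1 -ldual_yd_coact.
apply: eq_tsum => x0 x1.
by rewrite ldual_yd_ract (rb_mul1r hR) -ldual_tgtr (rb_mul1l hR).
Qed.

Lemma ldual_yd_module : is_right_module (@rr_act k A D E).
Proof.
split=> [|x|x X Y].
- split=> [X|x] c y z; apply: ldual_yd_eq => f;
    rewrite ldualDE ldualZE !ldual_yd_act -tsum_linear; apply: eq_tsum => f1 f0.
    rewrite ldualDE ldualZE; case: (rb_src hR) => -> _ _.
    by rewrite mulDr (bilZr (rb_mul_bilinear hR)) ldualD evZ.
  by rewrite ldualDE ldualZE.
- apply: ldual_yd_eq => f; rewrite ldual_yd_act -[in RHS](lc_counit (lr_comod hT) f).
  rewrite (morph_tsum _ _ (xD x)); apply: eq_tsum => f1 f0.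
  by rewrite ldual_ev_one // (rb_counit_srcr hR) xl.
apply: ldual_yd_eq => f; rewrite !ldual_yd_act.
have tri : tribalanced (@bract k A R) (@blact k A R) (@bract k A R) (@lr_lact k A R T)
  (fun al1 al2 f0 => ev Y (al1 ** bsrc (ev X (al2 ** bsrc (evT x f0))))).
  split=> [g|al]; first exact: ldual_mul_src_balanced.
  exact: balanced_comp (ldual_ev_src_additive hR Y al)
    (ldual_yd_act_balanced x X).
under [RHS]eq_tsum => f1 f0.
  rewrite ldual_yd_act (morph_tsum _ _ (ldual_ev_src_additive hR Y f1)); over.
rewrite -(lc_coassoc_sum hT f tri); apply: eq_tsum => f1 f0.
rewrite (ldual_evM hR) (rb_comul_srcr hR).
by rewrite (tsum_tsum _ _ _ (ldual_mul_balanced hR X Y)).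
Qed.

(** As for [rdual_yd_left_right], the function applied to the condition of [T]
    being that of [ldual_yd_act_balanced]. *)
Lemma ldual_yd_right_right : yd_right_right E.
Proof.
split.
- exact: ldual_yd_comodule.
- exact: ldual_yd_module.
- move=> x a; apply: ldual_yd_eq => f; rewrite ldual_yd_act ldual_yd_ract.
  rewrite -[in RHS](lc_counit (lr_comod hT) f) (morph_tsum _ _ (xD x)).
  rewrite (morph_tsum (h := *%R^~ a)); last by move=> y z; apply: mulrDl.
  apply: eq_tsum => f1 f0; rewrite ldual_ev_src // !(rb_counit_srcr hR).
  by rewrite xl.
- move=> x a; apply: ldual_yd_eq => f.
  rewrite ldual_yd_act ldual_yd_lact (lr_act_src hT).
  rewrite -[in RHS](lc_counit (lr_comod hT) (lr_ract f a)) (lr_coact_ract hR hT).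
  rewrite (tsum_tsum _ _ _ (lc_counit_balanced hR hT)) (morph_tsum _ _ (xD x)).
  apply: eq_tsum => f1 f0; rewrite ldual_ev_tgt // mulA (rb_counit_srcr hR).
  by rewrite xl (rb_counit_srcl_tgtl hR).
move=> x X; apply: (ldual_tensor2_eq hR rE fT) => f be.
have bp := pair_balanced f be; have ba := ldual_yd_act_balanced x X.
rewrite !(tsum_bind _ _ bp).
(* The value of [X1] acts on [lr_act f be1] through a source, hence appears as
   a target in the coaction, where [ldual_ev_comul] absorbs it. *)
transitivity (\tsum_(be1, be2 <- bcomul be) \tsum_(g1, g0 <- lr_coact (lr_act f be1))
    ev X (be2 ** g1 ** bsrc (evT x g0))).
  transitivity (\tsum_(X1, X2 <- bcomul X) \tsum_(be1, be2 <- bcomul be)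
      evT (rr_act x X2) (lr_ract (lr_act f be1) (ev X1 be2))).
    apply: eq_tsum => X1 X2; rewrite (tsum_tsum _ _ _ bp).
    under eq_tsum => x0 x1.
      rewrite (ldual_evM hR) (rb_comul_tgtl hR).
      rewrite (tsum_tsum _ _ _ (ldual_mul_balanced hR X1 x1)).
      under eq_tsum do rewrite -mulA.
      over.
    rewrite exchange_tsum; apply: eq_tsum => be1 be2.
    by rewrite ldual_yd_coact actM (lr_act_src hT).
  rewrite exchange_tsum; apply: eq_tsum => be1 be2.
  under eq_tsum => X1 X2.
    rewrite ldual_yd_act (lr_coact_ract hR hT).
    rewrite (tsum_tsum _ _ _ (ldual_yd_act_balanced x X2)).
    over.
  rewrite exchange_tsum; apply: eq_tsum => g1 g0.
  under eq_tsum do rewrite -mulA.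
  by rewrite (ldual_ev_comul hR fR) mulA.
have := congr1 (fun u => tsum u (fun g1 g0 => ev X (g1 ** bsrc (evT x g0))))
  (lr_yd hT f be).
rewrite /= !(tsum_bind _ _ ba).
under eq_tsum do rewrite (tsum_tsum _ _ _ ba).
move=> ->.
under eq_tsum do rewrite (tsum_tsum _ _ _ ba).
under [RHS]eq_tsum => x0 x1.
  rewrite (tsum_tsum _ _ _ bp).
  under eq_tsum => X1 X2.
    rewrite (ldual_evM hR) (rb_comul_tgtl hR).
    rewrite (tsum_tsum _ _ _ (ldual_mul_balanced hR x1 X2)) ldual_yd_act.
    under eq_tsum => be1 be2.
      rewrite -mulA (morph_tsum _ _ (ldual_ev_tgt_additive hR X2 _)).
      over.
    rewrite exchange_tsum.
    over.
  rewrite exchange_tsum.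
  over.
rewrite [RHS]exchange_tsum; apply: eq_tsum => f1 f0.
under [RHS]eq_tsum => x0 x1.
  rewrite exchange_tsum.
  under eq_tsum do rewrite (ldual_ev_comul hR fR) -mulA (mulA (bsrc _)) mulA.
  rewrite (rb_takeuchi_sum hR _ _ (ldual_mul_mull_balanced hR x1 X f1)).
  over.
rewrite [RHS]exchange_tsum; apply: eq_tsum => be1 be2.
by rewrite -ldual_yd_coact (morph_tsum _ _ (ldual_ev_src_additive hR X _)).
Qed.

End LeftDualYD.

(** * Left-right biduality *)

Section LeftBidual.
Variables (k : fieldType) (A : algType k) (R : bialgebroid_data A).
Hypothesis hR : right_bialgebroid R.
Hypothesis fR : left_fgp (@blact k A R).

Local Notation D := (ldual_bialgebroid R).
Local Notation ev := (@ldual_fun k A R (@blact k A R)).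
Local Notation h := (@bialgebroid_ev_lr k A R).

Let hD := ldual_right_bialgebroid hR fR.
Let fD : right_fgp (@bract k A D) := ldual_right_fgp fR (ldual_ev_bract hR).

Let hE al (X : D) : h al X = ev X al.
Proof. exact: bialgebroid_ev_lrE. Qed.

Lemma bialgebroid_ev_lr_iso : bialgebroid_iso h.
Proof.
split.
- exact: ldual_bidual_bij fR (ldual_ev_bract hR) hE.
- move=> c al be; apply: rdual_eq => X.
  rewrite rdualDE rdualZE !hE ldualD.
  by rewrite (ldualZ _ (blact_bilinear hR) (blact1 hR)).
- move=> al be; apply: rdual_eq => X; rewrite hE [RHS](rdual_mulE hD).
  rewrite -(ldual_ev_comul hR fR); apply: eq_tsum => X1 X2.
  by rewrite !hE (ldual_ev_tgtr hR).
- by apply: rdual_eq => X; rewrite [LHS]hE [RHS](rdual_oneE hD).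
- move=> a; apply: rdual_eq => X; rewrite hE [RHS](rdual_srcE hD).
  by rewrite [RHS](ldual_ev_tgtl hR) (rb_mul1r hR).
- move=> a; apply: rdual_eq => X; rewrite hE [RHS](rdual_tgtE hD).
  by rewrite [RHS](ldual_ev_tgtr hR) (rb_mul1r hR).
- move=> al; apply: (rdual_comulP hD (h al) fD).2 => X Y.
  rewrite (tsum_tsum _ _ _ (rdual_comul_balanced hD X Y)) hE (ldual_evM hR).
  apply: eq_tsum => al1 al2.
  by rewrite !hE (ldual_ev_srcl hR).
by move=> al; rewrite [LHS]hE; apply: ldual_ev_one.
Qed.

Section Module.
Variable T : lr_data R.
Hypothesis hT : yd_left_right T.
Hypothesis fT : left_fgp (@lr_lact k A R T).

Local Notation E := (ldual_yd T).
Local Notation evT := (@ldual_fun k A T (@lr_lact k A R T)).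

Let hYD := ldual_yd_right_right hR hT fR fT.

Definition yd_ev_lr (f : T) : rdual_yd E := rdual_of _ (fun x : E => evT x f).

Let gE f (x : E) : yd_ev_lr f x = evT x f.
Proof. by rewrite rdual_ofE //; split=> // y a; apply: ldual_yd_ract. Qed.

Let fE : right_fgp (@rr_ract k A D E).
Proof. exact: ldual_right_fgp fT (@ldual_yd_ract k A R T). Qed.

Lemma yd_ev_lr_iso : lr_iso h yd_ev_lr.
Proof.
have lB := lr_lact_bilinear hT; split.
- exact: ldual_bidual_bij fT (@ldual_yd_ract k A R T) gE.
- move=> c f g; apply: rdual_eq => x.
  rewrite rdualDE rdualZE !gE; case: (ldualP x) => -> _.
  by rewrite (ldualZ _ lB (lr_lact1 hT)).
- move=> a f; apply: rdual_eq => x; rewrite gE [RHS]rdual_lactE gE.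
  by case: (ldualP x) => _ ->.
- move=> f a; apply: rdual_eq => x; rewrite gE [RHS](rdual_ractE hD hYD) gE.
  by rewrite (rr_act_tgt hYD) (ldual_yd_lact hT) (lr_act_src hT).
- move=> f al; apply: rdual_eq => x; rewrite gE [RHS](rdual_actE hD hYD).
  rewrite -(ldual_yd_coact hR hT fT); apply: eq_tsum => x0 x1.
  by rewrite hE gE (ldual_ev_tgtr hR).
move=> f; apply: (rdual_coactP hD hYD (yd_ev_lr f) fE).2 => x X.
rewrite (tsum_tsum _ _ _ (rdual_coact_balanced hD x X)) gE.
rewrite (ldual_yd_act hR hT); apply: eq_tsum => f1 f0.
by rewrite hE gE (ldual_ev_srcl hR).
Qed.

End Module.
End LeftBidual.

(** * Duality of Yetter-Drinfeld modules *)

Theorem theorem5p9 (k : fieldType) (A : algType k) :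
  (forall (R : bialgebroid_data A) (L : rr_data R),
     right_bialgebroid R -> yd_right_right L ->
     right_fgp (@bract k A R) -> right_fgp (@rr_ract k A R L) ->
     [/\ right_bialgebroid (rdual_bialgebroid R),
         yd_left_right (rdual_yd L),
         left_fgp (@lr_lact k A _ (rdual_yd L)),
         bialgebroid_iso (@bialgebroid_ev_rl k A R) &
         exists g : L -> ldual_yd (rdual_yd L),
           rr_iso (@bialgebroid_ev_rl k A R) g]) /\
  (forall (Om : bialgebroid_data A) (T : lr_data Om),
     right_bialgebroid Om -> yd_left_right T ->
     left_fgp (@blact k A Om) -> left_fgp (@lr_lact k A Om T) ->
     [/\ right_bialgebroid (ldual_bialgebroid Om),
         yd_right_right (ldual_yd T),
         right_fgp (@rr_ract k A _ (ldual_yd T)),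
         bialgebroid_iso (@bialgebroid_ev_lr k A Om) &
         exists g : T -> rdual_yd (ldual_yd T),
           lr_iso (@bialgebroid_ev_lr k A Om) g]).
Proof.
split=> [R L hR hL fR fL|R T hR hT fR fT]; split.
- exact: rdual_right_bialgebroid.
- exact: rdual_yd_left_right.
- exact: rdual_left_fgp fL (@rdual_yd_lact k A R L).
- exact: bialgebroid_ev_rl_iso.
- by exists (@yd_ev_rl k A R L); apply: yd_ev_rl_iso.
- exact: ldual_right_bialgebroid.
- exact: ldual_yd_right_right.
- exact: ldual_right_fgp fT (@ldual_yd_ract k A R T).
- exact: bialgebroid_ev_lr_iso.
by exists (@yd_ev_lr k A R T); apply: yd_ev_lr_iso.
Qed.
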